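(* Let $a>0$, $T>0$, $K=[-a,a]$, and let $f:[0,T]\times\mathbb R\to\mathbb R$ be a Carathéodory function with $|f(t,x)|\le m(t)$ for all $(t,x)\in[0,T]\times\mathbb R$, where $m\in L^1([0,T])$, and such that for some $\alpha\in L^1([0,T])$ one has $|f(t,x)-f(t,y)|\le\alpha(t)|x-y|$ for a.e. $t\in[0,T]$ and all $x,y\in\mathbb R$. Let $x_v,x_w$ be two solutions on $[0,T]$ of the impulsive Cauchy problem $$\ddot x(t)=f(t,x(t))\ \text{ for a.e. } t,\qquad \dot x(s+)=-\dot x(s)\ \text{ if } |x(s)|=a,\qquad x(0)=0,$$ with initial velocities $\dot x_v(0)=v>\|m\|_1$ and $\dot x_w(0)=w>\|m\|_1$, and with impulse times $t_1,\ldots,t_k$ and $s_1,\ldots,s_{k+j}$, respectively. If $j\ge 2$, then there exists a solution of the impulsive Dirichlet problem $$\ddot x(t)=f(t,x(t))\ \text{ for a.e. } t\in[0,T],\ |x(t)|<a;\qquad \dot x(s+)=-\dot x(s)\ \text{ if } |x(s)|=a;\qquad x(0)=x(T)=0.$$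
   Context: Carathéodory means: $f(\cdot,x)$ is measurable for every $x$ and $f(t,\cdot)$ is continuous for a.e. $t\in[0,T]$. $\|m\|_1$ is the $L^1([0,T])$-norm of $m$. A solution (of either problem) is a continuous function $x:[0,T]\to[-a,a]$ which has an absolutely continuous derivative on intervals where $|x(t)|<a$, satisfies $\ddot x(t)=f(t,x(t))$ for a.e. $t$ with $|x(t)|<a$, satisfies the impulse condition $\dot x(s+)=-\dot x(s)$ at every time $s$ with $|x(s)|=a$ (here $\dot x(s)$ is the velocity just before the impact, i.e. the left-hand one, and $\dot x(s+)$ the right-hand one; at $s=T$ there is no condition on $\dot x(s+)$), and satisfies the indicated initial or boundary condition. The impulse (impact) times of $x$ are the times $s\in[0,T]$ with $|x(s)|=a$. *)

(* Defs.v *)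
From HB Require Import structures.
From mathcomp Require Import all_boot all_order all_algebra.
From mathcomp Require Import all_classical all_reals all_analysis.

Set Implicit Arguments.
Unset Strict Implicit.
Unset Printing Implicit Defensive.

Import Order.TTheory GRing.Theory Num.Theory.
Import numFieldNormedType.Exports.

Local Open Scope classical_set_scope.
Local Open Scope ring_scope.

(* The real line with the sigma-algebra of Lebesgue-measurable sets. The
   default sigma-algebra on R is the Borel one, which is too small for
   "measurable" and "L^1" in their usual sense. *)
Definition lebesgueR (R : realType) :=
  caratheodory_type ((wlength (@idfun R))^*)%mu.

Notation leb := (@completed_lebesgue_measure _).

(* D = [0, T] gives the derivative of a function on [0, T], one-sided at the
   end points; D = [0, t] and D = [t, T] give the left-hand and right-hand
   derivatives at t. *)
Definition has_deriv_within (R : realType) (D : set R) (g : R -> R)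
    (t l : R) : Prop :=
  (fun s => (g s - g t) / (s - t)) @ within D t^' --> l.

Definition absolutely_continuous_on (R : realType) (D : set R)
    (g : R -> R) : Prop :=
  forall e : R, 0 < e -> exists2 d : R, 0 < d &
    forall (n : nat) (u v : 'I_n -> R),
      (forall i, [/\ D (u i), D (v i) & u i <= v i]) ->
      trivIset setT (fun i => `]u i, v i[%classic) ->
      \sum_(i < n) (v i - u i) < d ->
      \sum_(i < n) `|g (v i) - g (u i)| < e.

Definition seg (R : realType) (T : R) : set (lebesgueR R) := `[0, T]%classic.

Definition caratheodory_fun (R : realType) (T : R) (f : R -> R -> R) : Prop :=
  (forall x : R, measurable_fun (seg T) (f ^~ x)) /\
  {ae leb, forall t : lebesgueR R,
     t \in `[0, T] -> continuous (f t : R -> R)}.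

Definition L1_fun (R : realType) (T : R) (m : R -> R) : Prop :=
  leb.-integrable (seg T) (fun t => (m t)%:E).

Definition L1_norm (R : realType) (T : R) (m : R -> R) : \bar R :=
  (\int[leb]_(t in (seg T)) (`|m t|)%:E)%E.

Definition impact_times (R : realType) (a T : R) (x : R -> R) : set R :=
  [set s | 0 <= s <= T /\ `|x s| = a].

(* x solves the impulsive equation on [0, T], before any initial or boundary
   condition; g is its velocity at the times where |x| < a. The impulse
   condition is only about 0 < s < T: it is void at T, and the problems below
   have x(0) = 0, so that 0 is not an impact time. *)
Definition impulsive_solution (R : realType) (a T : R) (f : R -> R -> R)
    (x : R -> R) : Prop :=
  [/\ {within `[0, T]%classic, continuous x},
      (forall t, 0 <= t <= T -> - a <= x t <= a),
      (exists g : R -> R,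
        [/\ (forall t, 0 <= t <= T -> `|x t| < a ->
               has_deriv_within `[0, T]%classic x t (g t)),
            (forall I : set R, is_interval I ->
               I `<=` [set t | 0 <= t <= T /\ `|x t| < a] ->
               absolutely_continuous_on I g) &
            {ae leb, forall t : lebesgueR R,
               t \in `[0, T] -> `|x t| < a ->
               has_deriv_within `[0, T]%classic g t (f t (x t))}]) &
      (forall s, 0 < s < T -> `|x s| = a ->
         exists l : R, has_deriv_within `[0, s]%classic x s l /\
                       has_deriv_within `[s, T]%classic x s (- l))].

Definition cauchy_solution (R : realType) (a T : R) (f : R -> R -> R)
    (v : R) (x : R -> R) : Prop :=
  [/\ impulsive_solution a T f x, x 0 = 0 & has_deriv_within `[0, T]%classic x 0 v].

Definition dirichlet_solution (R : realType) (a T : R) (f : R -> R -> R)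
    (x : R -> R) : Prop :=
  [/\ impulsive_solution a T f x, x 0 = 0 & x T = 0].

(* Main.v *)
Require Import Defs.
From mathcomp Require Import all_boot all_order all_algebra.
From mathcomp Require Import all_classical all_reals all_analysis.
From mathcomp Require Import measurable_realfun.
From mathcomp Require Import ring lra.
Import Order.TTheory GRing.Theory Num.Theory.
Import numFieldNormedType.Exports.
Local Open Scope classical_set_scope.
Local Open Scope ring_scope.
Set Implicit Arguments.
Unset Strict Implicit.
Unset Printing Implicit Defensive.

(** The theorem is proved by unfolding. Instead of reflecting the ball at the
    walls of the strip between [- a] and [a], reflect the strip: the ball then
    moves on a line, an impact is a passage through an odd multiple of [a], and
    the velocity does not jump. Since the initial velocities exceed the integral
    of [m], the unfolded velocity stays positive. The unfolded position [y] is
    therefore increasing, and the number of impacts tells how far it gets: for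
    the velocity [v], with [k] impacts, [y T < (2 k + 1) a]; for [w], with at
    least [k + 2] impacts, [y T >= (2 k + 3) a] ([unfolded_impacts_lt],
    [unfolded_impacts_ge]). The position [2 (k + 1) a], which folds to [0], lies
    strictly between. A motion that ends there is a solution of the Dirichlet
    problem, and it is found at an initial velocity between [v] and [w], by
    continuity.

    Continuous dependence on the initial velocity is used for approximations
    only. Euler's method on a grid, with the sign that jumps at the walls replaced
    by a difference quotient of the triangle wave ([slope]), has a final position
    that is continuous in the initial velocity [lam] ([euler_continuous]). Along
    an ultrafilter on the numbers of steps the approximations converge, even if
    [lam] varies with the number of steps, and the limit is an unfolded motion
    ([euler_limit]): as the limit has positive velocity, it is at the walls only
    on a null set of times, so that dominated convergence identifies its force.
    For the velocities [v] and [w] uniqueness identifies the limits with the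
    given solutions ([cauchy_unique], [euler_limit_cauchy]). Hence for many
    numbers of steps the approximations with velocities [v] and [w] end on
    different sides of [2 (k + 1) a], the intermediate value theorem gives one
    that ends there, and the limit of these is the motion sought.

    Uniqueness holds although the unfolded equation is discontinuous in the
    position: it is checked for the folded solutions by induction along the time
    interval ([real_induction]), and just after an impact both solutions are
    inside the strip, where the Lipschitz condition applies ([unique_right]).

    Two facts carry the measure theory. A primitive [prim h] of an integrable
    function is absolutely continuous with derivative [h] almost everywhere
    ([prim_ac], [prim_deriv]); and the increment of an absolutely continuous
    function is at most the integral of any bound on its derivative
    ([abs_cont_increment_le]). *)

(** * One-sided derivatives *)

Lemma has_deriv_withinP (R : realType) (D : set R) (g : R -> R) (t l : R) :
  has_deriv_within D g t l <->
  forall e, 0 < e -> exists2 d, 0 < d & forall s, D s -> `|s - t| < d ->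
    `|g s - g t - l * (s - t)| <= e * `|s - t|.
Proof.
rewrite /has_deriv_within; split=> [/cvgrPdist_le H e e0|H].
  have := H e e0; rewrite !near_withinE => -[d /= d0 Hd].
  exists d => // s Ds std.
  have [->|st] := eqVneq s t; first by rewrite !subrr mulr0 subr0 normr0 mulr0.
  have st0 : s - t != 0 by rewrite subr_eq0.
  have := Hd s; rewrite /ball/= distrC => /(_ std st Ds) Hs.
  rewrite (_ : g s - g t - l * (s - t) = (s - t) * - (l - (g s - g t) / (s - t))).
    by rewrite normrM mulrC ler_wpM2r// normrN.
  by field.
apply/cvgrPdist_le => e e0; rewrite !near_withinE.
have [d d0 Hd] := H e e0; exists d => // s /=; rewrite distrC => std st Ds.
have st0 : s - t != 0 by rewrite subr_eq0.
have n0 : 0 < `|s - t| by rewrite normr_gt0.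
have := Hd s Ds std.
rewrite (_ : l - _ = - ((g s - g t - l * (s - t)) / (s - t))); last by field.
by rewrite normrN normrM normfV ler_pdivrMr.
Qed.

Lemma has_deriv_within_subset (R : realType) (D D' : set R) (g : R -> R) (t l : R) :
  (exists2 d, 0 < d & forall s, D' s -> `|s - t| < d -> D s) ->
  has_deriv_within D g t l -> has_deriv_within D' g t l.
Proof.
move=> [d d0 DD'] /has_deriv_withinP H; apply/has_deriv_withinP => e e0.
have [d' d'0 Hd] := H e e0; exists (Num.min d d'); first by rewrite lt_min d0.
move=> s D's; rewrite lt_min => /andP[sd sd']; apply: Hd => //; exact: DD'.
Qed.

Lemma has_deriv_within_eq (R : realType) (D : set R) (g h : R -> R) (t l : R) :
  (exists2 d, 0 < d & forall s, D s -> `|s - t| < d -> g s = h s) -> g t = h t ->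
  has_deriv_within D g t l -> has_deriv_within D h t l.
Proof.
move=> [d d0 gh] ght /has_deriv_withinP H; apply/has_deriv_withinP => e e0.
have [d' d'0 Hd] := H e e0; exists (Num.min d d'); first by rewrite lt_min d0.
by move=> s Ds; rewrite lt_min => /andP[sd sd']; rewrite -gh// -ght; apply: Hd.
Qed.

Lemma has_deriv_within_lin (R : realType) (D : set R) (g h : R -> R) (c t l k : R) :
  has_deriv_within D g t l -> has_deriv_within D h t k ->
  has_deriv_within D (fun s => c * g s + h s) t (c * l + k).
Proof.
move=> gl hk; rewrite /has_deriv_within.
have -> : (fun s => (c * g s + h s - (c * g t + h t)) / (s - t)) =
    (fun s => c * ((g s - g t) / (s - t)) + (h s - h t) / (s - t)).
  by apply/funext => s; ring.
by apply: cvgD => //; exact: cvgMl_tmp.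
Qed.

Lemma has_deriv_within_cst (R : realType) (D : set R) (c t : R) :
  has_deriv_within D (cst c) t 0.
Proof.
apply/has_deriv_withinP => e e0; exists 1 => // s _ _.
by rewrite /= !subrr mul0r subr0 normr0 mulr_ge0// ltW.
Qed.

Lemma is_derive_has_deriv (R : realType) (g : R -> R) (t l : R) :
  is_derive t (1 : R) g l <-> has_deriv_within setT g t l.
Proof.
have E : (h^-1 *: ((g \o shift t) (h *: (1 : R)) - g t) @[h --> 0^'] --> l) <->
    has_deriv_within setT g t l.
  split=> [/cvgrPdist_le H|/has_deriv_withinP H].
    apply/has_deriv_withinP => e e0.
    have := H e e0; rewrite near_withinE => -[/= d d0 Hd]; exists d => // s _ st.
    have [->|nst] := eqVneq s t; first by rewrite !subrr mulr0 subr0 normr0 mulr0.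
    have st0 : s - t != 0 by rewrite subr_eq0.
    have := Hd (s - t); rewrite /ball/= sub0r normrN => /(_ st st0).
    rewrite /shift /= -[_ *: (1 : R)]/((s - t) * 1) mulr1 subrK.
    rewrite -[_ *: _]/((s - t)^-1 * (g s - g t)) => Hs.
    rewrite (_ : _ - _ - _ = (s - t) * - (l - (s - t)^-1 * (g s - g t))).
      by rewrite normrM mulrC ler_wpM2r// normrN.
    by field.
  apply/cvgrPdist_le => e e0; rewrite near_withinE.
  have [d d0 Hd] := H e e0; exists d => //= h; rewrite /ball/= sub0r normrN => hd h0.
  have := Hd (h + t) I; rewrite addrK => /(_ hd).
  rewrite /shift /= -[_ *: (1 : R)]/(h * 1) mulr1 -[_ *: _]/(h^-1 * _).
  rewrite (_ : l - _ = - (h^-1 * (g (h + t) - g t - l * h))); last by field.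
  by rewrite normrN normrM normfV ler_pdivrMl ?normr_gt0// [`|h| * e]mulrC.
split=> [[dg dl]|dg]; first by apply/E; rewrite -dl; exact: dg.
have {}dg := E.2 dg; split; first by apply/cvg_ex; exists l.
by rewrite /derive; apply: cvg_lim dg; exact: Rhausdorff.
Qed.

Lemma within_continuousP (R : realType) (D : set R) (g : R -> R) :
  {within D, continuous g} <->
  forall t, D t -> forall e, 0 < e -> exists2 d, 0 < d &
    forall s, D s -> `|s - t| < d -> `|g s - g t| <= e.
Proof.
split=> [/subspace_continuousP H t Dt e e0|H].
  have /cvgrPdist_le/(_ e e0) := H t Dt.
  rewrite near_withinE => -[/= d d0 Hd]; exists d => // s Ds st.
  by rewrite distrC; apply: Hd => //; rewrite /ball/= distrC.
apply/subspace_continuousP => t Dt; apply/cvgrPdist_le => e e0.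
rewrite near_withinE; have [d d0 Hd] := H t Dt e e0.
by exists d => //= s; rewrite /ball/= distrC => st Ds; rewrite distrC; apply: Hd.
Qed.

Lemma has_deriv_within_continuous (R : realType) (D : set R) (g : R -> R) :
  (forall t, D t -> exists l, has_deriv_within D g t l) ->
  {within D, continuous g}.
Proof.
move=> dg; apply/within_continuousP => t Dt e e0.
have [l /has_deriv_withinP/(_ 1 ltr01)[d d0 Hd]] := dg t Dt.
have l0 : 0 < 1 + `|l| by rewrite ltr_wpDr.
exists (Num.min d (e / (1 + `|l|))); first by rewrite lt_min d0 divr_gt0.
move=> s Ds; rewrite lt_min => /andP[sd]; rewrite ltr_pdivlMr// => se.
apply: le_trans (ltW se); rewrite mulrDr mulr1.
have := Hd s Ds sd; rewrite mul1r => H.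
rewrite (_ : g s - g t = g s - g t - l * (s - t) + l * (s - t)); last by ring.
by rewrite (le_trans (ler_normD _ _))// lerD// normrM mulrC.
Qed.

Lemma itv_near_right_end (R : realType) (s r d : R) : s < r -> 0 < d ->
  exists x, [/\ `[s, r]%classic x, x != r & `|x - r| < d].
Proof.
move=> sr d0; exists (Num.max s (r - d / 2)).
have lr : Num.max s (r - d / 2) < r by rewrite gt_max sr gtrBl divr_gt0.
split; first by rewrite /= in_itv/= le_max lexx (ltW lr).
  by rewrite lt_eqF.
rewrite distrC gtr0_norm ?subr_gt0//.
have : r - d / 2 <= Num.max s (r - d / 2) by rewrite le_max lexx orbT.
lra.
Qed.

Lemma itv_near_left_end (R : realType) (s r d : R) : s < r -> 0 < d ->
  exists x, [/\ `[s, r]%classic x, x != s & `|x - s| < d].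
Proof.
move=> sr d0; exists (Num.min r (s + d / 2)).
have lr : s < Num.min r (s + d / 2) by rewrite lt_min sr ltrDl divr_gt0.
split; first by rewrite /= in_itv/= ge_min lexx (ltW lr).
  by rewrite gt_eqF.
rewrite gtr0_norm ?subr_gt0//.
have : Num.min r (s + d / 2) <= s + d / 2 by rewrite ge_min lexx orbT.
lra.
Qed.

Lemma has_deriv_within_unique (R : realType) (D : set R) (g : R -> R) (t l k : R) :
  (forall d, 0 < d -> exists s, [/\ D s, s != t & `|s - t| < d]) ->
  has_deriv_within D g t l -> has_deriv_within D g t k -> l = k.
Proof.
move=> acc /has_deriv_withinP Hl /has_deriv_withinP Hk.
apply/eqP; rewrite -subr_eq0 -normr_le0; apply/ler_addgt0Pr => e e0; rewrite add0r.
have e20 : 0 < e / 2 by rewrite divr_gt0.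
have [d d0 Hd] := Hl _ e20; have [d' d'0 Hd'] := Hk _ e20.
have [|s [Ds st]] := acc (Num.min d d'); first by rewrite lt_min d0.
rewrite lt_min => /andP[sd sd'].
have n0 : 0 < `|s - t| by rewrite normr_gt0 subr_eq0.
rewrite -(ler_pM2r n0) -normrM.
rewrite (_ : (l - k) * (s - t) = (g s - g t - k * (s - t)) - (g s - g t - l * (s - t))); last by ring.
rewrite (le_trans (ler_normB _ _))// (le_trans (lerD (Hd' _ _ _) (Hd _ _ _)))//.
by rewrite -mulrDl -splitr.
Qed.

(** * Lebesgue-measurable sets and Borel sets *)

Lemma lebE (R : realType) (A : set R) : leb A = @lebesgue_measure R A.
Proof. by []. Qed.

Lemma borel_leb (R : realType) (A : set (measurableTypeR R)) :
  measurable A -> measurable (A : set (lebesgueR R)).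
Proof. exact: sub_caratheodory. Qed.

Lemma leb_measurableE (R : realType) (A : set (lebesgueR R)) : measurable A ->
  exists2 X : set (measurableTypeR R), measurable X &
  exists2 N, (@lebesgue_measure R).-negligible N & X `|` N = A.
Proof.
move=> mA.
have : (completed_algebra_gen (@lebesgue_measure R)).-sigma.-measurable A.
  by rewrite completed_caratheodory_measurable.
by rewrite g_sigma_completed_algebra_genE => -[X mX [N nN <-]]; exists X => //; exists N.
Qed.

Lemma leb_negligibleE (R : realType) (A : set (lebesgueR R)) :
  leb.-negligible A <-> (@lebesgue_measure R).-negligible (A : set R).
Proof.
split=> [[N [mN N0 AN]]|[N [mN N0 AN]]]; last first.
  by exists N; split => //; exact: borel_leb.
have [X mX [M [M' [mM' M'0 MM']] XMN]] := leb_measurableE mN.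
exists (X `|` M'); split; first exact: measurableU.
  apply: null_set_setU => //.
  apply/eqP; rewrite -measure_le0 -N0; apply: le_outer_measure.
  by rewrite -XMN; exact: subsetUl.
by apply: subset_trans AN _; rewrite -XMN; exact: setUS.
Qed.

Lemma leb_aeE (R : realType) (P : R -> Prop) :
  {ae leb, forall t : lebesgueR R, P t} <->
  {ae @lebesgue_measure R, forall t, P t}.
Proof. exact: leb_negligibleE. Qed.

Lemma ae_neq (R : realType) (c : R) : {ae leb, forall t : lebesgueR R, t != c}.
Proof.
apply/leb_aeE; exists [set c]; split => //; first exact: lebesgue_measure_set1.
by move=> x /= /negP; rewrite negbK => /eqP.
Qed.

Lemma measurable_leb_itv (R : realType) (i : interval R) :
  measurable ([set` i] : set (lebesgueR R)).
Proof. exact: borel_leb. Qed.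

(** A real function is determined by countably many of its superlevel sets, and
    each of them is Borel up to a null set. *)
Lemma measurable_modification (R : realType) (D : set R) (h : R -> R) :
  measurable D ->
  measurable_fun (D : set (lebesgueR R)) (h : lebesgueR R -> R) ->
  exists N : set R, [/\ measurable N, lebesgue_measure N = 0%E &
    measurable_fun (D `\` N) h].
Proof.
move=> mD mh.
have part (q : rat) : exists XN : set R * set R,
    [/\ measurable XN.1, measurable XN.2, lebesgue_measure XN.2 = 0%E,
     XN.1 `<=` D `&` h @^-1` `]ratr q, +oo[ &
     D `&` h @^-1` `]ratr q, +oo[ `<=` XN.1 `|` XN.2].
  have mq : measurable (D `&` h @^-1` `]ratr q, +oo[ : set (lebesgueR R)).
    by apply: mh; [exact: borel_leb|exact: measurable_itv].
  have [X mX [M [M' [mM' M'0 MM']] XMN]] := leb_measurableE mq.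
  exists (X, M'); split=> //; rewrite -XMN; first exact: subsetUl.
  exact: setUS.
have [XN XNP] := choice part.
have mN : measurable (\bigcup_q (XN q).2).
  by apply: bigcupT_measurable_rat => q; have [] := XNP q.
exists (\bigcup_q (XN q).2); split=> //.
  apply: measure_negligible => //.
  have -> : \bigcup_q (XN q).2 = \bigcup_n
      (if unpickle n is Some q then (XN q).2 else set0).
    apply/seteqP; split=> [x [q _ qx]|x [n _]].
      by exists (pickle q); [exact: I|rewrite pickleK].
    by case: (unpickle n) => // q qx; exists q.
  apply: negligible_bigcup => n; case: (unpickle n) => [q|].
    by have [_ ? ? _ _] := XNP q; exists (XN q).2; split.
  exact: negligible_set0.
apply: (measurability _ (RGenOInfty.measurableE R)) => _ [_ [r ->] <-].
rewrite (_ : _ `&` _ = (\bigcup_q (if r < ratr q then (XN q).1 else set0))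
    `\` \bigcup_q (XN q).2).
  apply: measurableD => //; apply: bigcupT_measurable_rat => q.
  by case: ifP => // _; have [] := XNP q.
apply/seteqP; split=> x /=.
  rewrite in_itv/= andbT => -[[Dx Nx] rh]; split=> //.
  have [q] := rat_in_itvoo rh; rewrite in_itv/= => /andP[rq qh].
  exists q => //; rewrite rq; have [_ _ _ _ sub] := XNP q.
  have /sub[//|xN] : (D `&` h @^-1` `]ratr q, +oo[) x.
    by split=> //=; rewrite in_itv/= qh.
  by exfalso; apply: Nx; exists q.
move=> [[q _]]; case: ifP => // rq Xx Nx.
have [_ _ _ sub _] := XNP q; have [Dx] := sub x Xx.
rewrite /= !in_itv/= !andbT => qh; split=> //; exact: lt_trans qh.
Qed.

(** * Primitives of integrable functions *)

Definition prim (R : realType) (h : R -> R) (t : R) : R :=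
  (\int[leb]_(s in (`[0%R, t]%classic : set (lebesgueR R))) h s)%R.

(** Replacing an integrable [h] by a Borel function equal to it almost
    everywhere lets the Lebesgue differentiation theorem, which is about Borel
    functions, apply to [prim h]. *)
Lemma prim_borel (R : realType) (T : R) (h : R -> R) : L1_fun T h ->
  exists b : R -> R, [/\ lebesgue_measure.-integrable setT (EFin \o b),
    {ae leb, forall t : lebesgueR R, t \in `[0, T] -> b t = h t} &
    forall t, 0 <= t <= T ->
      prim h t = (\int[lebesgue_measure]_(s in `[0, t]) b s)%R].
Proof.
move=> ih; have mT : measurable (seg T) by exact: measurable_leb_itv.
have mh : measurable_fun (`[0, T]%classic : set (lebesgueR R)) h.
  by apply/measurable_EFinP; case/integrableP: ih.
have [N [mN N0 mhN]] := @measurable_modification R `[0, T]%classic h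
  (measurable_itv _) mh.
have mTN : measurable (`[0, T]%classic `\` N) by exact: measurableD.
pose b := h \_ (`[0, T]%classic `\` N).
have mb : measurable_fun [set: R] b by apply/(measurable_restrictT _ mTN).
have mbl (A : set (lebesgueR R)) : measurable A ->
    measurable_fun A (b : lebesgueR R -> R).
  move=> mA; apply: (@measurable_funS _ _ _ _ setT) => //.
  move=> _ B mB; rewrite setTI; apply: borel_leb.
  by rewrite -[X in measurable X]setTI; exact: mb.
have bh : {ae leb, forall t : lebesgueR R, t \in `[0, T] -> b t = h t}.
  exists N; split; [exact: borel_leb|exact: N0|] => t /= /not_implyP[tT].
  rewrite /b patchE; case: ifPn => // /negP; rewrite in_setE => ntN _.
  by apply: contrapT => nNt; apply: ntN; split.
have ibl (A : set R) : measurable A ->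
    leb.-integrable (A : set (lebesgueR R)) (EFin \o b : lebesgueR R -> \bar R).
  move=> mA; apply: (@integrableS _ _ _ _ setT) => //; first exact: borel_leb.
  suff : leb.-integrable setT (EFin \o (h \_ (`[0, T]%classic `\` N)) : lebesgueR R -> \bar R).
    by [].
  rewrite -restrict_EFin; apply: (integrable_mkcond _ _).1; first exact: borel_leb.
  by apply: (integrableS mT _ _ ih); [exact: borel_leb|exact: subDsetl].
have mid : measurable_fun [set: lebesgueR R] (idfun : lebesgueR R -> measurableTypeR R).
  by move=> _ B mB; rewrite setTI; exact: borel_leb.
have mEb : measurable_fun [set: R] (EFin \o b) by exact/measurable_EFinP.
exists b; split=> //.
  exact: (integrable_pushforward mid (mu := leb) mEb (ibl _ measurableT)).
move=> t /andP[t0 tT].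
have m0t : measurable (`[0, t]%classic : set (measurableTypeR R)) by exact: measurable_itv.
rewrite /prim /Rintegral; congr fine.
rewrite -[RHS]/(\int[pushforward leb (idfun : lebesgueR R -> measurableTypeR R)]_(s in `[0%R, t]%classic) (b s)%:E)%E.
rewrite (integral_pushforward mid mEb (ibl _ m0t))//.
have ih' : leb.-integrable (`[0, t]%classic : set (lebesgueR R)) (EFin \o h).
  apply: (integrableS mT _ _ ih); first exact: borel_leb.
  by apply: subset_itvl; rewrite bnd_simp.
apply: ae_eq_integral; [exact: borel_leb| | |].
- by case/integrableP: ih'.
- by apply/measurable_EFinP; apply: mbl; exact: borel_leb.
- apply: filterS bh => s bs /=; rewrite in_itv/= => /andP[s0 st].
  by rewrite bs// in_itv/= s0 (le_trans st).
Qed.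

Lemma seg_integrable (R : realType) (T s t : R) (b0 b1 : bool) (h : R -> R) :
  L1_fun T h -> 0 <= s -> t <= T ->
  leb.-integrable ([set` Interval (BSide b0 s) (BSide b1 t)] : set (lebesgueR R))
    (EFin \o h).
Proof.
move=> ih s0 tT; apply: (integrableS _ _ _ ih); try exact: measurable_leb_itv.
apply: subset_itv; first by case: b0; rewrite bnd_simp.
by case: b1; rewrite bnd_simp// ltW.
Qed.

Lemma L1_lin (R : realType) (T c : R) (g h : R -> R) :
  L1_fun T g -> L1_fun T h -> L1_fun T (fun t => c * g t + h t).
Proof.
move=> ig ih.
apply: (@eq_integrable _ _ _ leb _ _ ((fun t => c%:E * (g t)%:E) \+ (EFin \o h))%E).
- exact: measurable_leb_itv.
- by [].
- apply: integrableD => //; first exact: measurable_leb_itv.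
  by apply: integrableZl => //; exact: measurable_leb_itv.
Qed.

Lemma L1_cst0 (R : realType) (T : R) : L1_fun T (cst 0).
Proof. exact: integrable0. Qed.

Lemma prim_lin (R : realType) (T c t : R) (g h : R -> R) :
  L1_fun T g -> L1_fun T h -> 0 <= t <= T ->
  prim (fun t => c * g t + h t) t = c * prim g t + prim h t.
Proof.
move=> ig ih /andP[t0 tT]; rewrite /prim.
have ig' := seg_integrable true false ig (lexx 0) tT.
have ih' := seg_integrable true false ih (lexx 0) tT.
have m0t := @measurable_leb_itv R `[0, t].
rewrite RintegralD//; first by rewrite RintegralZl.
apply: (@eq_integrable _ _ _ leb _ _ (fun t => c%:E * (g t)%:E)%E) => //.
exact: integrableZl.
Qed.

Lemma prim_cst0 (R : realType) (t : R) : prim (cst 0) t = 0.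
Proof. by rewrite /prim Rintegral_cst ?mul0r//; exact: measurable_leb_itv. Qed.

Lemma prim_at0 (R : realType) (h : R -> R) : prim h 0 = 0.
Proof.
rewrite /prim /Rintegral set_itv1 -[RHS]/(fine 0%E); congr (fine _).
have m0 : measurable ([set 0] : set (lebesgueR R)) by exact: borel_leb.
have mu0 : leb ([set 0] : set (lebesgueR R)) = 0%E.
  by rewrite lebE; exact: lebesgue_measure_set1.
apply: (null_set_integral m0 _ mu0); apply/measurable_EFinP.
exact: measurable_fun_set1.
Qed.

Lemma prim_sub (R : realType) (T s t : R) (h : R -> R) : L1_fun T h ->
  0 <= s -> s <= t -> t <= T ->
  prim h t - prim h s = (\int[leb]_(r in (`]s, t]%classic : set (lebesgueR R))) h r)%R.
Proof.
move=> ih s0 st tT; apply/eqP; rewrite subr_eq addrC; apply/eqP.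
rewrite /prim (@itv_bndbnd_setU _ _ _ (BRight s))//.
rewrite Rintegral_setU//; try exact: measurable_leb_itv.
- rewrite -itv_bndbnd_setU//; first exact: seg_integrable ih (lexx 0) tT.
- by apply/disj_setPS => x /= []; rewrite !in_itv/= => /andP[_ xs] /andP[]; rewrite ltNge xs.
Qed.

Lemma prim_le (R : realType) (T s t : R) (h mu : R -> R) :
  L1_fun T h -> L1_fun T mu -> 0 <= s -> s <= t -> t <= T ->
  {ae leb, forall r : lebesgueR R, s <= r <= t -> `|h r| <= mu r} ->
  `|prim h t - prim h s| <= prim mu t - prim mu s.
Proof.
move=> ih imu s0 st tT hmu.
rewrite (prim_sub ih)// (prim_sub imu)//.
have mst := @measurable_leb_itv R `]s, t].
have ih' := seg_integrable false false ih s0 tT.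
have imu' := seg_integrable false false imu s0 tT.
apply: le_trans (le_normr_Rintegral mst ih') _.
have ia : leb.-integrable (`]s, t]%classic : set (lebesgueR R)) (EFin \o (Num.Def.normr \o h)).
  exact: integrable_norm.
have [N [mN N0 hN]] := hmu.
have mD : measurable (`]s, t]%classic `\` N : set (lebesgueR R)) by exact: measurableD.
rewrite /Rintegral (negligible_integral mN mst ia N0).
rewrite (negligible_integral mN mst imu' N0).
apply: (le_Rintegral (mu := leb) mD).
- by apply: (integrableS mst mD _ ia); exact: subDsetl.
- by apply: (integrableS mst mD _ imu'); exact: subDsetl.
move=> x [] /=; rewrite in_itv/= => /andP[sx xt] nNx.
apply: contrapT => hx; apply: nNx; apply: hN => /= /(_ _)/hx; apply.
by rewrite ltW.
Qed.

Lemma prim_eq (R : realType) (T s t : R) (g h : R -> R) :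
  L1_fun T g -> L1_fun T h -> 0 <= s -> s <= t -> t <= T ->
  {ae leb, forall r : lebesgueR R, s <= r <= t -> g r = h r} ->
  prim g t - prim g s = prim h t - prim h s.
Proof.
move=> ig ih s0 st tT gh.
have i0 := L1_cst0 T; have igh := L1_lin (-1) ih ig.
have := prim_le igh i0 s0 st tT.
rewrite !(prim_lin (T := T))// ?(le_trans s0)// ?s0 ?(le_trans st)// !prim_cst0.
rewrite subrr normr_le0 => H.
apply/eqP; rewrite -subr_eq0; apply/eqP.
transitivity (-1 * prim h t + prim g t - (-1 * prim h s + prim g s)); first ring.
apply/eqP; apply: H; apply: filterS gh => r /[apply] ->.
by rewrite mulN1r addNr normr0.
Qed.

Lemma prim_ge0 (R : realType) (T s t : R) (h : R -> R) :
  L1_fun T h -> (forall r, 0 <= r <= T -> 0 <= h r) ->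
  0 <= s -> s <= t -> t <= T -> prim h s <= prim h t.
Proof.
move=> ih h0 s0 st tT; rewrite -subr_ge0.
apply: le_trans (normr_ge0 _) (prim_le (L1_cst0 T) ih s0 st tT _).
apply: aeW => r /andP[sr rt]; rewrite normr0 h0//.
by rewrite (le_trans s0)// (le_trans rt).
Qed.

Lemma prim_deriv (R : realType) (T : R) (h : R -> R) : L1_fun T h ->
  {ae leb, forall t : lebesgueR R, t \in `[0, T] ->
     has_deriv_within `[0, T] (prim h) t (h t)}.
Proof.
move=> ih; have [b [ib bh hb]] := prim_borel ih.
have iby y : lebesgue_measure.-integrable [set` Interval (BLeft 0) (BRight y)] (EFin \o b).
  by apply: (integrableS _ _ _ ib).
have locb : locally_integrable [set: R] b.
  by apply: open_integrable_locally => //; exact: openT.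
have /leb_aeE := @FTC1 R b (BLeft 0) iby locb.
move=> db; have fae := ae_filter_ringOfSetsType (@completed_lebesgue_measure R).
apply: (@filterS3 _ _ fae _ _ _ _ _ db bh (ae_neq 0)) => t {}db {}bh nt0 t0T; move: (t0T).
rewrite in_itv/= => /andP[t0 tT].
have [|d1 d2] := db; first by rewrite lte_fin lt_neqAle eq_sym nt0.
have dt := (is_derive_has_deriv _ _ _).1 (DeriveDef d1 (etrans (esym (derive1E _ _)) d2)).
rewrite -bh//; apply: has_deriv_within_eq (has_deriv_within_subset _ dt).
- exists 1 => // s; rewrite /= in_itv/= => s0T _; exact/esym/hb.
- by rewrite hb// t0.
- by exists 1.
Qed.

Lemma prim_sub_oo (R : realType) (T s t : R) (h : R -> R) : L1_fun T h ->
  0 <= s -> s <= t -> t <= T ->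
  (prim h t - prim h s)%:E =
  (\int[leb]_(r in (`]s, t[%classic : set (lebesgueR R))) (h r)%:E)%E.
Proof.
move=> ih s0 st tT; rewrite (prim_sub ih)// /Rintegral.
have mt : measurable ([set t] : set (lebesgueR R)) by exact: borel_leb.
have mst := @measurable_leb_itv R `]s, t].
have ih' := seg_integrable false false ih s0 tT.
have t00 : leb ([set t] : set (lebesgueR R)) = 0%E by exact: lebesgue_measure_set1.
rewrite fineK; last exact: integrable_fin_num.
rewrite (negligible_integral mt mst ih' t00); congr (integral _ _ _).
apply/seteqP; split=> r /=; rewrite !in_itv/=.
  by move=> [/andP[-> rt] /eqP nrt]; rewrite lt_neqAle nrt.
move=> /andP[sr rt]; rewrite sr ltW//; split=> //.
by move=> rtE; rewrite rtE ltxx in rt.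
Qed.

Lemma prim_sum_le (R : realType) (T : R) (nu : R -> R) (n : nat) (u v : 'I_n -> R) :
  L1_fun T nu -> (forall t, 0 <= t <= T -> 0 <= nu t) ->
  (forall i, [/\ `[0, T]%classic (u i), `[0, T]%classic (v i) & u i <= v i]) ->
  trivIset setT (fun i => `]u i, v i[%classic) ->
  \sum_(i < n) (prim nu (v i) - prim nu (u i)) <= fine (\int[leb]_(t in seg T) (nu t)%:E).
Proof.
move=> inu nu0 uv tuv; have mT : measurable (seg T) by exact: measurable_leb_itv.
rewrite -lee_fin -sumEFin fineK; last exact: integrable_fin_num.
have uvT i : `]u i, v i[%classic `<=` `[0, T]%classic.
  have [/=] := uv i; rewrite !in_itv/= => /andP[u0 _] /andP[_ vT] _.
  move=> r /=; rewrite !in_itv/= => /andP[ur rv].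
  by rewrite (le_trans u0 (ltW ur)) (le_trans (ltW rv)).
rewrite (eq_bigr (fun i => \int[leb]_(r in (`]u i, v i[%classic : set (lebesgueR R))) (nu r)%:E)%E); last first.
  move=> i _; have [/=] := uv i; rewrite !in_itv/= => /andP[u0 _] /andP[_ vT] uvi.
  exact: (@prim_sub_oo _ T).
have mnu : measurable_fun (seg T) (EFin \o nu) by case/integrableP: inu.
have UT : \big[setU/set0]_(i <- index_enum 'I_n) (`]u i, v i[%classic : set (lebesgueR R)) `<=` seg T.
  by rewrite -bigcup_seq => r [i _]; exact: uvT.
rewrite -(@ge0_integral_bigsetU _ _ _ leb _ (fun i => (`]u i, v i[%classic : set (lebesgueR R)))).
- apply: ge0_subset_integral => //.
  + by apply: bigsetU_measurable => i _; exact: measurable_leb_itv.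
- by move=> i; exact: measurable_leb_itv.
- exact: index_enum_uniq.
- by apply: sub_trivIset tuv.
- exact: measurable_funS mnu.
- by move=> r /UT; rewrite /seg /= in_itv/= lee_fin; exact: nu0.
Qed.

Lemma leb_seg (R : realType) (t : R) : 0 <= t -> leb (seg t) = t%:E.
Proof.
move=> t0; transitivity (lebesgue_measure (`[0%R, t]%classic : set R)); first by [].
rewrite lebesgue_measure_itv/= lte_fin.
by case: ltgtP t0 => //= [_ _|<- _]//; rewrite oppr0 adde0.
Qed.

Lemma L1_cst (R : realType) (T c : R) : 0 <= T -> L1_fun T (cst c).
Proof.
move=> T0; have mT : measurable (seg T) by exact: measurable_leb_itv.
apply: (measurable_bounded_integrable mT) => //.
  by rewrite -[X in (X < _)%E]/(leb (seg T)) leb_seg// ltry.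
by exists `|c|; split=> // x cx y _; exact: ltW.
Qed.

Lemma prim_cst (R : realType) (c t : R) : 0 <= t -> prim (cst c) t = c * t.
Proof.
move=> t0; rewrite /prim (@Rintegral_cst _ _ _ leb); last exact: measurable_leb_itv.
by rewrite -[X in fine X]/(leb (seg t)) leb_seg.
Qed.

(** The part of [h] that is not small in mean is a bounded simple function, and
    for bounded functions absolute continuity is the Lipschitz property. *)
Lemma prim_ac (R : realType) (T : R) (h : R -> R) : 0 <= T -> L1_fun T h ->
  absolutely_continuous_on `[0, T] (prim h).
Proof.
move=> T0 ih e e0; have mT : measurable (seg T) by exact: measurable_leb_itv.
have [g [ig _ hg]] := approximation_sfun_integrable mT ih.
have e20 : 0 < e / 2 by rewrite divr_gt0.
have [n hgn] : exists n, (\int[leb]_(z in seg T)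
    `|(h z)%:E - (HBSimple.SimpleFun.sort (g n) z)%:E| < (e / 2)%:E)%E.
  have [[N _ HN] /cvgrPdist_lt/(_ _ e20)[M _ HM]] := (fine_cvgP _ _).1 hg.
  exists (maxn N M); have := HM (maxn N M) (leq_maxr _ _).
  rewrite /= sub0r normrN => /ltr_normlW; rewrite -lte_fin fineK//.
  exact: HN (leq_maxl _ _).
pose gn : R -> R := HBSimple.SimpleFun.sort (g n).
have ign : L1_fun T gn by exact: ig.
have [K gK] : exists K : R, forall z, `|gn z| <= K.
  have [K [_ gK]] := simple_bounded (g n).
  by exists (K + 1) => z; apply: gK => //; rewrite ltrDl.
have K1 : 0 < `|K| + 1 by rewrite ltr_wpDl.
have iZ : L1_fun T (fun t => -1 * gn t + h t) by exact: L1_lin.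
pose nu := fun t => `|-1 * gn t + h t|.
have inu : L1_fun T nu by exact: integrable_norm.
exists (e / 2 / (`|K| + 1)); first by rewrite divr_gt0.
move=> k u v uv tuv suv.
have i1 : L1_fun T (fun t => (`|K| + 1) * cst 1 t + nu t).
  by apply: L1_lin => //; exact: L1_cst.
have : \sum_(i < k) `|prim h (v i) - prim h (u i)| <=
    \sum_(i < k) ((`|K| + 1) * (v i - u i) + (prim nu (v i) - prim nu (u i))).
  apply: ler_sum => i _; have [/=] := uv i.
  rewrite !in_itv/= => /andP[u0 uT] /andP[v0 vT] uvi.
  have := @prim_le R T (u i) (v i) h _ ih i1 u0 uvi vT.
  rewrite !(prim_lin (T := T)) ?u0 ?v0//; [|exact: L1_cst..].
  rewrite !prim_cst// !mul1r => H.
  apply: le_trans (H _) _; last by rewrite le_eqVlt; apply/orP; left; apply/eqP; ring.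
  apply: aeW => r _; rewrite /= mulr1 /nu.
  have -> : `|h r| = `|(-1 * gn r + h r) + gn r| by congr (`|_|); ring.
  rewrite (le_trans (ler_normD _ _))// addrC lerD2r.
  by rewrite (le_trans (gK r))// (le_trans (ler_norm _))// lerDl.
move=> /le_lt_trans; apply; rewrite big_split/= -mulr_sumr [e]splitr.
apply: ltr_leD; first by rewrite mulrC -ltr_pdivlMr.
apply: le_trans (prim_sum_le inu (fun _ _ => normr_ge0 _) uv tuv) _.
rewrite -lee_fin fineK; last exact: integrable_fin_num.
apply/ltW; apply: le_lt_trans hgn; rewrite le_eqVlt; apply/orP; left; apply/eqP.
apply: eq_integral => r _; rewrite /nu -EFinB abse_EFin; congr (_%:E).
by congr (`|_|); rewrite mulN1r addrC.
Qed.

(** Dominated convergence; completeness of the measure makes the limit, which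
    exists only almost everywhere, measurable. *)
Lemma prim_dct (R : realType) (T : R) (m h : R -> R) (h_ : nat -> R -> R) :
  L1_fun T m ->
  (forall n, measurable_fun (seg T) (h_ n : lebesgueR R -> R)) ->
  (forall n t, 0 <= t <= T -> `|h_ n t| <= m t) ->
  {ae leb, forall t : lebesgueR R, t \in `[0, T] -> h_ ^~ t @ \oo --> h t} ->
  L1_fun T h /\ forall t, 0 <= t <= T -> prim (h_ n) t @[n --> \oo] --> prim h t.
Proof.
move=> im mh hm hh; have mT : measurable (seg T) by exact: measurable_leb_itv.
have [N [mN N0 hN]] := hh.
pose k_ n := (h_ n) \_ (~` N); pose k := h \_ (~` N).
have mk n : measurable_fun (seg T) (k_ n : lebesgueR R -> R).
  apply/measurable_restrict; [exact: measurableC|exact: mT|].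
  by apply: measurable_funS (mh n).
have mh' : measurable_fun (seg T) (h : lebesgueR R -> R).
  apply/measurable_EFinP.
  apply: (ae_measurable_fun completed_lebesgue_measure_is_complete (f := EFin \o k)).
    exists N; split=> // t /= /not_implyP[tT]; rewrite /k patchE.
    by case: ifPn => // /negP; rewrite in_setE => /contrapT.
  apply/measurable_EFinP.
  apply: (measurable_fun_cvg (h := k_)) => //= t tT; rewrite /k_ /k.
  rewrite [X in X @ _ --> _](_ : _ = (fun n => if t \in ~` N then h_ n t else 0)); last first.
    by apply/funext => n; rewrite patchE.
  rewrite patchE; case: ifPn => [|_]; last exact: cvg_cst.
  rewrite in_setE => nNt; apply: contrapT => nc; apply: nNt; apply: hN => /= Ht.
  exact/nc/Ht.
have D t : 0 <= t <= T -> L1_fun t h /\ prim (h_ n) t @[n --> \oo] --> prim h t.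
  move=> /andP[t0 tT].
  have sub : (`[0, t]%classic : set (lebesgueR R)) `<=` seg T.
    by apply: subset_itvl; rewrite bnd_simp.
  have [] := @dominated_convergence _ _ _ leb (seg t) (@measurable_leb_itv R `[0, t])
    (fun n => EFin \o h_ n) (EFin \o h) (EFin \o m).
  - by move=> n; apply/measurable_EFinP; exact: (measurable_funS mT sub (mh n)).
  - by apply/measurable_EFinP; exact: (measurable_funS mT sub mh').
  - apply: filterS hh => s H /sub sT; apply/cvg_EFin; last exact: H.
    by near=> n.
  - exact: seg_integrable im (lexx 0) tT.
  - apply: aeW => s n /sub; rewrite /seg/= in_itv/= => sT.
    by rewrite lee_fin; exact: hm.
  move=> ih _; rewrite -(fineK (integrable_fin_num (@measurable_leb_itv R `[0, t]) ih)).
  by move=> /fine_cvgP[].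
split=> [|t /D[]//]; have [T0|T0] := leP 0 T; first by have [] := D T; rewrite ?T0 ?lexx.
rewrite /L1_fun (_ : seg T = set0); first exact: integrable_set0.
by rewrite /seg set_itv_ge// bnd_simp -ltNge.
Unshelve. all: by end_near. Qed.

(** * Absolutely continuous functions *)

Lemma abs_cont_subset (R : realType) (D D' : set R) (g : R -> R) :
  D' `<=` D -> absolutely_continuous_on D g -> absolutely_continuous_on D' g.
Proof.
move=> DD' H e e0; have [d d0 Hd] := H e e0; exists d => // n u v uv.
by apply: Hd => i; have [Du Dv uvi] := uv i; split=> //; exact: DD'.
Qed.

Lemma abs_cont_lin (R : realType) (D : set R) (c : R) (g h : R -> R) :
  absolutely_continuous_on D g -> absolutely_continuous_on D h ->
  absolutely_continuous_on D (fun t => c * g t + h t).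
Proof.
move=> Hg Hh e e0.
have c1 : 0 < `|c| + 1 by rewrite ltr_wpDl.
have [|d d0 Hd] := Hg (e / 2 / (`|c| + 1)); first by rewrite !divr_gt0.
have [|d' d'0 Hd'] := Hh (e / 2); first by rewrite divr_gt0.
exists (Num.min d d'); first by rewrite lt_min d0.
move=> n u v uv tuv; rewrite lt_min => /andP[sd sd'].
have {}Hd := Hd n u v uv tuv sd; have {}Hd' := Hd' n u v uv tuv sd'.
have : \sum_(i < n) `|c * g (v i) + h (v i) - (c * g (u i) + h (u i))| <=
    \sum_(i < n) ((`|c| + 1) * `|g (v i) - g (u i)| + `|h (v i) - h (u i)|).
  apply: ler_sum => i _.
  rewrite (_ : _ - _ = c * (g (v i) - g (u i)) + (h (v i) - h (u i))); last by ring.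
  rewrite (le_trans (ler_normD _ _))// lerD2r normrM ler_wpM2r//.
  by rewrite lerDl.
move=> /le_lt_trans; apply; rewrite big_split/= -mulr_sumr [e]splitr.
by apply: ltrD => //; rewrite mulrC -ltr_pdivlMr.
Qed.

Lemma abs_cont_eq (R : realType) (D : set R) (g h : R -> R) :
  (forall t, D t -> g t = h t) ->
  absolutely_continuous_on D g -> absolutely_continuous_on D h.
Proof.
move=> gh H e e0; have [d d0 Hd] := H e e0; exists d => // n u v uv tuv suv.
rewrite (eq_bigr (fun i => `|g (v i) - g (u i)|)); first exact: Hd.
by move=> i _; have [Du Dv _] := uv i; rewrite !gh.
Qed.

Lemma abs_cont_scale (R : realType) (D : set R) (c : R) (g : R -> R) :
  absolutely_continuous_on D g -> absolutely_continuous_on D (fun t => c * g t).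
Proof.
move=> acg; apply: (@abs_cont_eq _ _ (fun t => c * g t + cst 0 t)).
  by move=> t _; rewrite addr0.
apply: abs_cont_lin => // e e0; exists 1 => // n u v _ _ _.
by rewrite big1// => i _; rewrite subrr normr0.
Qed.

Lemma abs_cont_continuous (R : realType) (s t : R) (g : R -> R) :
  absolutely_continuous_on `[s, t] g -> {within `[s, t], continuous g}.
Proof.
move=> acg; apply/within_continuousP => r rst e e0.
have [d d0 Hd] := acg e e0; exists d => // x xst xr.
wlog xler : x r rst xst xr / x <= r => [wl|].
  have [xr'|/ltW rx] := leP x r; first exact: wl.
  by rewrite distrC; apply: wl => //; rewrite distrC.
have := Hd 1%N (fun=> x) (fun=> r); rewrite !big_ord1 distrC => H; apply/ltW/H => //.
  by apply/trivIsetP => i j; rewrite !ord1 eqxx.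
by move: xr; rewrite ltr_norml; lra.
Qed.

(** Induction along an interval: the supremum of the times before which [P]
    holds can neither fail [P] nor come before the end. *)
Lemma real_induction (R : realType) (s t : R) (P : R -> Prop) : s <= t ->
  (forall r, s <= r <= t -> (forall u, s <= u < r -> P u) ->
     exists2 d, 0 < d & forall v, r <= v < r + d -> v <= t -> P v) ->
  P t.
Proof.
move=> st step; pose S := [set x | s <= x <= t /\ forall u, s <= u < x -> P u].
have Ss : S s by split=> [|u]; rewrite ?lexx// => /andP[/le_lt_trans/[apply]]; rewrite ltxx.
have hS : has_sup S by split; [exists s|exists t => x [/andP[]]].
have s_sup : s <= sup S by apply: ub_le_sup => //; case: hS.
have sup_t : sup S <= t by apply: ge_sup => [|x [/andP[]]]; first by exists s.
have Psup u : s <= u < sup S -> P u.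
  move=> /andP[su usup]; have [|x [_ Px] ux] := @sup_adherent _ S (sup S - u) _ hS.
    by rewrite subr_gt0.
  by apply: Px; rewrite su; rewrite opprB addrC subrK in ux.
have [|d d0 Pd] := step (sup S) _ Psup; first by rewrite s_sup.
have [td|dt] := ltP t (sup S + d); first by apply: Pd => //; rewrite sup_t.
suff : S (sup S + d).
  move=> /(ub_le_sup (proj2 hS)).
  by rewrite gerDl leNgt d0.
split=> [|u /andP[su ud]]; first by rewrite dt (le_trans s_sup)// lerDl ltW.
have [uS|Su] := ltP u (sup S); first by apply: Psup; rewrite su.
by apply: Pd; rewrite ?Su// (le_trans (ltW ud)).
Qed.

Lemma separated_trivIset (R : realType) (L : seq (R * R)) :
  pairwise (fun p q : R * R => q.2 <= p.1) L ->
  trivIset setT (fun i => `](tnth (in_tuple L) i).1, (tnth (in_tuple L) i).2[%classic).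
Proof.
move=> pL; apply/trivIsetP => i j _ _ ij.
wlog ltij : i j ij / (i < j)%N => [wl|].
  have := ij; rewrite neq_ltn => /orP[]; first exact: wl.
  by rewrite setIC; apply: wl; rewrite eq_sym.
have sep : (tnth (in_tuple L) j).2 <= (tnth (in_tuple L) i).1.
  rewrite !(tnth_nth (0, 0))/=.
  by apply: (pairwiseP (0, 0) pL); rewrite ?inE.
apply/seteqP; split=> // r [] /=; rewrite !in_itv/= => /andP[ur _] /andP[_ rv].
by have := lt_trans ur rv; rewrite ltNge sep.
Qed.

Lemma abs_cont_seq (R : realType) (s t e : R) (H : R -> R) :
  absolutely_continuous_on `[s, t] H -> 0 < e ->
  exists2 d, 0 < d & forall L : seq (R * R),
    (forall p, p \in L -> s <= p.1 /\ p.1 <= p.2 /\ p.2 <= t) ->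
    pairwise (fun p q : R * R => q.2 <= p.1) L ->
    \sum_(p <- L) (p.2 - p.1) < d ->
    \sum_(p <- L) `|H p.2 - H p.1| < e.
Proof.
move=> acH e0; have [d d0 Hd] := acH e e0; exists d => // L Lst pL.
rewrite big_tnth => sd; rewrite big_tnth.
pose u i := (tnth (in_tuple L) i).1; pose v i := (tnth (in_tuple L) i).2.
apply: (Hd _ u v) => // [i|].
  have [su [uv vt]] := Lst _ (mem_tnth i (in_tuple L)).
  by rewrite /= !in_itv/= su uv (le_trans su uv) vt (le_trans uv vt).
exact: separated_trivIset.
Qed.

Lemma separated_length_le (R : realType) (U : set R) (L : seq (R * R)) :
  measurable U -> (forall p, p \in L -> p.1 <= p.2 /\ `]p.1, p.2[%classic `<=` U) ->
  pairwise (fun p q : R * R => q.2 <= p.1) L ->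
  ((\sum_(p <- L) (p.2 - p.1))%:E <= lebesgue_measure U)%E.
Proof.
move=> mU LU pL; rewrite big_tnth.
pose u i := (tnth (in_tuple L) i).1; pose v i := (tnth (in_tuple L) i).2.
have tuv : trivIset setT (fun i => `]u i, v i[%classic).
  exact: separated_trivIset.
have -> : ((\sum_(i < size L) (v i - u i))%:E =
    lebesgue_measure (\big[setU/set0]_(i < size L) `]u i, v i[%classic))%E.
  rewrite measure_bigsetU_ord//.
  rewrite -sumEFin; apply: eq_bigr => i _; apply: esym.
  apply: etrans (lebesgue_measure_itv _) _; rewrite /= lte_fin.
  have [uv _] := LU _ (mem_tnth i (in_tuple L)).
  by case: ltgtP uv => // -> _; rewrite subrr.
apply: le_measure; rewrite ?inE//.
  by apply: bigsetU_measurable => i _; exact: measurable_itv.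
rewrite -bigcup_seq => r [i _] ri.
have [_] := LU _ (mem_tnth i (in_tuple L)); exact.
Qed.

(** The usual proof covers the exceptional null set in the manner of Vitali.
    Here [real_induction] replaces the covering: moving right from [s], each
    point where the derivative is nonnegative costs [eps] per unit of length,
    and each exceptional point is crossed by an interval inside an open set of
    small measure, whose total cost absolute continuity bounds. *)
Lemma abs_cont_nondecreasing (R : realType) (s t : R) (H : R -> R) : s <= t ->
  absolutely_continuous_on `[s, t] H ->
  {ae leb, forall r : lebesgueR R, r \in `[s, t] ->
     exists2 l, 0 <= l & has_deriv_within `[s, t] H r l} ->
  H s <= H t.
Proof.
move=> st acH /leb_aeE[N [mN N0 badN]]; apply/ler_addgt0Pr => e e0.
have c0 : 0 < t - s + 1 by rewrite ltr_wpDl// subr_ge0.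
pose eps := e / (t - s + 1); have eps0 : 0 < eps by rewrite divr_gt0.
have [d d0 Hd] := abs_cont_seq acH eps0.
have [|U [oU NU UN]] := lebesgue_regularity_outer mN _ d0; first by rewrite -[X in (X < _)%E]/(lebesgue_measure N) N0 ltry.
have mU : measurable U by exact: open_measurable.
have Ud : (lebesgue_measure U < d%:E)%E.
  apply: le_lt_trans UN; rewrite -[leLHS](_ : lebesgue_measure ((U `\` N) `|` N) = _)%E.
    rewrite (le_trans (measureU2 _ _ _))//; first exact: measurableD.
    by rewrite [X in (_ + X <= _)%E](_ : _ = 0%E) ?adde0//; exact: N0.
  by rewrite setUC setDUK.
pose P r := exists L : seq (R * R), [/\
  (forall p, p \in L -> s <= p.1 /\ p.1 <= p.2 /\ p.2 <= r),
  (forall p, p \in L -> `]p.1, p.2[%classic `<=` U),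
  pairwise (fun p q : R * R => q.2 <= p.1) L &
  H s <= H r + eps * (r - s) + \sum_(p <- L) `|H p.2 - H p.1|].
have [L [Lst LU pL HL]] : P t.
  apply: (real_induction st) => r /andP[sr rt] Pr.
  have prev d' : 0 < d' -> exists u, [/\ s <= u, u <= r, r - d' < u & P u].
    move=> d'0; have [srE|nsr] := eqVneq s r.
      exists r; split=> //; rewrite ?ltrBlDr ?ltrDl//.
      by exists [::]; split=> //; rewrite big_nil addr0 srE subrr mulr0 addr0.
    have ltsr : s < r by rewrite lt_neqAle nsr.
    pose u := Num.max s (r - d' / 2); have ur : u < r.
      by rewrite gt_max ltsr gtrBl divr_gt0.
    exists u; split; rewrite ?le_max ?lexx ?(ltW ur)//.
      rewrite lt_max; apply/orP; right; rewrite ltrD2l ltrN2.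
      by rewrite ltr_pdivrMr// ltr_pMr// ltr1n.
    by apply: Pr; rewrite le_max lexx ur.
  have [Nr|nNr] := pselect (N r).
    move: oU; rewrite openE => /(_ r (NU r Nr)) /nbhs_ballP[d' /= d'0 rU].
    exists d' => // v /andP[rv vd'] vt.
    have [u [su ur ud' [L [Lsu LU pL HL]]]] := prev d' d'0.
    exists ((u, v) :: L); split=> [p|p||].
    - rewrite inE => /predU1P[->/=|/Lsu[sp [pp pu]]].
        by rewrite su lexx (le_trans ur).
      by rewrite sp pp (le_trans pu)// (le_trans ur).
    - rewrite inE => /predU1P[->/= x|/LU//].
      rewrite /= in_itv/= => /andP[ux xv]; apply: rU.
      rewrite /ball/= ltr_distlC; apply/andP; split; first exact: lt_trans ud' ux.
      exact: lt_trans xv vd'.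
    - rewrite pairwise_cons pL andbT; apply/allP => p /Lsu[_ [_]]; exact.
    - rewrite big_cons/=; apply: le_trans HL _.
      have e1 : eps * (u - s) <= eps * (v - s).
        by rewrite ler_pM2l// lerD2r (le_trans ur).
      have e2 : H u - H v <= `|H v - H u| by rewrite distrC ler_norm.
      lra.
  have [l l0 Hr] : exists2 l, 0 <= l & has_deriv_within `[s, t] H r l.
    apply: contrapT => nl; apply: nNr; apply: badN => /= /(_ _)/nl; apply.
    by rewrite in_itv/= sr.
  have [d' d'0 Hd'] := (has_deriv_withinP _ _ _ _).1 Hr eps eps0.
  exists d' => // v /andP[rv vd'] vt.
  have [u [su ur ud' [L [Lsu LU pL HL]]]] := prev d' d'0.
  exists L; split=> //.
    by move=> p /Lsu[sp [pp pu]]; rewrite sp pp (le_trans pu)// (le_trans ur).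
  have Hu : `|H u - H r - l * (u - r)| <= eps * (r - u).
    have -> : r - u = `|u - r| by rewrite distrC ger0_norm// subr_ge0.
    apply: Hd'; first by rewrite /= in_itv/= su (le_trans ur).
    by rewrite distrC ger0_norm ?subr_ge0//; lra.
  have Hv : `|H v - H r - l * (v - r)| <= eps * (v - r).
    have -> : eps * (v - r) = eps * `|v - r| by rewrite ger0_norm// subr_ge0.
    apply: Hd'; first by rewrite /= in_itv/= (le_trans sr)//.
    by rewrite ger0_norm ?subr_ge0//; lra.
  have lu : 0 <= l * (r - u) by rewrite mulr_ge0// subr_ge0.
  have lv : 0 <= l * (v - r) by rewrite mulr_ge0// subr_ge0.
  move: Hu Hv; rewrite !ler_norml => /andP[_ Hu] /andP[Hv _].
  lra.
have LUd : \sum_(p <- L) (p.2 - p.1) < d.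
  rewrite -lte_fin; apply: le_lt_trans Ud; apply: separated_length_le => // p pL'.
  by have [_ [? _]] := Lst p pL'; split=> //; exact: LU.
have := Hd L Lst pL LUd.
have : e = eps * (t - s) + eps by rewrite /eps; field; rewrite gt_eqF.
lra.
Qed.

(** Adding the primitive of the bound to [g] or to [- g] gives a nondecreasing
    function. Estimates of this kind stand in for the fundamental theorem of
    calculus for absolutely continuous functions. *)
Lemma abs_cont_increment_le (R : realType) (T s t : R) (g mu : R -> R) :
  L1_fun T mu -> 0 <= s -> s <= t -> t <= T ->
  absolutely_continuous_on `[s, t] g ->
  {ae leb, forall r : lebesgueR R, r \in `[s, t] ->
     exists2 l, `|l| <= mu r & has_deriv_within `[s, t] g r l} ->
  `|g t - g s| <= prim mu t - prim mu s.
Proof.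
move=> imu s0 st tT acg dg.
have stT : `[s, t]%classic `<=` `[0, T]%classic.
  by apply: subset_itv; rewrite bnd_simp.
have acp : absolutely_continuous_on `[s, t] (prim mu).
  by apply: abs_cont_subset stT _; apply: prim_ac => //; rewrite (le_trans s0)// (le_trans st).
have fae := ae_filter_ringOfSetsType (@completed_lebesgue_measure R).
have mono c : `|c| <= 1 -> c * g s + prim mu s <= c * g t + prim mu t.
  move=> c1; apply: (@abs_cont_nondecreasing _ s t (fun r => c * g r + prim mu r)) => //.
    exact: abs_cont_lin.
  apply: (@filterS2 _ _ fae _ _ _ _ dg (prim_deriv imu)) => r {}dg dmu rst.
  have [l lmu dgl] := dg rst; exists (c * l + mu r).
    have : `|c * l| <= mu r by rewrite normrM (le_trans _ lmu)// ler_piMl.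
    by rewrite ler_norml => /andP[? _]; rewrite -lerBlDr sub0r.
  apply: has_deriv_within_lin => //.
  apply: has_deriv_within_subset (dmu (stT r rst)).
  by exists 1 => // x xst _; exact: stT.
have := mono 1; rewrite normr1 lexx => /(_ isT) m1.
have := mono (-1); rewrite normrN1 lexx => /(_ isT) m2.
by rewrite ler_norml; apply/andP; split; lra.
Qed.

(** * Uniqueness for the impulsive Cauchy problem *)

Lemma has_deriv_within_is_derive (R : realType) (T : R) (x : R -> R) (t l : R) :
  0 < t < T -> has_deriv_within `[0, T] x t l -> is_derive t (1 : R) x l.
Proof.
move=> /andP[t0 tT] dx; apply/is_derive_has_deriv.
apply: has_deriv_within_subset dx; exists (Num.min t (T - t)).
  by rewrite lt_min t0 subr_gt0.
move=> s _; rewrite lt_min /= in_itv/= !ltr_norml => /andP[/andP[? ?] /andP[? ?]].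
by apply/andP; split; lra.
Qed.

(** Over an interval of length [d] that starts at [tau], the maximum [M] of the
    distance of the two solutions is at most [d * A * M], where [A] is the
    integral of the absolute value of [alpha]; hence [M] vanishes if [d] is
    small. *)
Lemma unique_right (R : realType) (T tau sigma l : R) (alpha : R -> R)
    (f : R -> R -> R) (x1 x2 g1 g2 : R -> R) :
  L1_fun T alpha ->
  {ae leb, forall t : lebesgueR R, t \in `[0, T] ->
     forall x y : R, `|f t x - f t y| <= alpha t * `|x - y|} ->
  0 <= tau -> tau < sigma -> sigma <= T ->
  {within `[0, T], continuous x1} -> {within `[0, T], continuous x2} ->
  x1 tau = x2 tau ->
  has_deriv_within `[tau, T] x1 tau l -> has_deriv_within `[tau, T] x2 tau l ->
  (forall t, tau < t < sigma -> has_deriv_within `[0, T] x1 t (g1 t)) ->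
  (forall t, tau < t < sigma -> has_deriv_within `[0, T] x2 t (g2 t)) ->
  absolutely_continuous_on `]tau, sigma[ g1 ->
  absolutely_continuous_on `]tau, sigma[ g2 ->
  {ae leb, forall t : lebesgueR R, tau < t < sigma ->
     has_deriv_within `[0, T] g1 t (f t (x1 t))} ->
  {ae leb, forall t : lebesgueR R, tau < t < sigma ->
     has_deriv_within `[0, T] g2 t (f t (x2 t))} ->
  exists2 d, 0 < d & forall t, tau <= t < tau + d -> x1 t = x2 t.
Proof.
move=> ialpha flip tau0 ts sT cx1 cx2 x12 dx1 dx2 dg1 dg2 ac1 ac2 ae1 ae2.
pose al t := `|alpha t|; have ial : L1_fun T al by exact: integrable_norm.
have al0 t : 0 <= al t by exact: normr_ge0.
pose A := prim al T.
have tau_T : tau < T by exact: lt_le_trans sT.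
have T0 : 0 <= T by rewrite (le_trans tau0)// ltW.
have A0 : 0 <= A.
  by rewrite /A -(prim_at0 al); apply: (prim_ge0 ial) => // r _; exact: al0.
have A1 : 0 < A + 1 by rewrite ltr_wpDl.
exists (Num.min (sigma - tau) (A + 1)^-1); first by rewrite lt_min subr_gt0 ts invr_gt0.
move=> c /andP[tauc cd].
have csigma : c < sigma.
  by move: cd; rewrite -ltrBlDl lt_min => /andP[+ _]; rewrite ltrD2r.
have cA : (c - tau) * A < 1.
  move: cd; rewrite -ltrBlDl lt_min => /andP[_]; rewrite -div1r ltr_pdivlMr//.
  by apply: le_lt_trans; rewrite ler_wpM2l ?subr_ge0// lerDl.
pose z t := -1 * x2 t + x1 t; pose g t := -1 * g2 t + g1 t.
have sub : `[tau, c]%classic `<=` `[0, T]%classic.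
  by apply: subset_itv; rewrite bnd_simp// (le_trans (ltW csigma)).
have cz : {within `[tau, c], continuous z}.
  have cz' : {within `[0, T], continuous z}.
    move=> t; apply: cvgD; last exact: cx1.
    by apply: cvgMl_tmp; exact: cx2.
  exact: continuous_subspaceW cz'.
have dz t : tau < t <= c -> is_derive t (1 : R) z (g t).
  move=> /andP[taut tc]; apply: (@has_deriv_within_is_derive _ T).
    by rewrite (le_lt_trans tau0)//= (lt_le_trans _ sT)// (le_lt_trans tc).
  have t_in : tau < t < sigma by rewrite taut (le_lt_trans tc).
  by apply: has_deriv_within_lin; [exact: dg2|exact: dg1].
have mvt t : tau < t <= c -> exists2 xi, tau < xi < t & z t = g xi * (t - tau).
  move=> /andP[taut tc].
  have [xi|//|xi] := @MVT _ z g tau t taut.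
  - rewrite in_itv/= => /andP[? xit]; apply: dz.
    by rewrite (le_trans (ltW xit))// andbT.
  - by apply: continuous_subspaceW cz; apply: subset_itvl; rewrite bnd_simp.
  - rewrite in_itv/= => xit; rewrite {2}/z x12 mulN1r addNr subr0 => ->.
    by exists xi.
have [m] : exists2 m, m \in `[tau, c] & forall t, t \in `[tau, c] -> `|z t| <= `|z m|.
  apply: (@EVT_max _ (fun t => `|z t|)) => //.
  by move=> t; apply: cvg_norm; exact: cz.
rewrite in_itv/= => /andP[taum mc] maxz.
suff M0 : `|z m| <= 0.
  have /maxz : c \in `[tau, c] by rewrite in_itv/= tauc lexx.
  move=> /le_trans/(_ M0); rewrite normr_le0 /z mulN1r addrC subr_eq0 => /eqP; exact.
have [->|nm] := eqVneq m tau; first by rewrite /z x12 mulN1r addNr normr0.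
have ltm : tau < m by rewrite lt_neqAle eq_sym nm.
set M := `|z m| in maxz *.
have M_ge0 : 0 <= M by exact: normr_ge0.
(* [e] bounds the difference of the velocities at some time close to [tau],
   which the mean value theorem provides *)
have gle e xi : 0 < e -> tau < xi < m -> `|g xi| <= M * A + e.
  move=> e0 /andP[tauxi xim].
  have dzr : has_deriv_within `[tau, T] z tau 0.
    have := @has_deriv_within_lin _ _ _ _ (-1) _ _ _ dx2 dx1.
    by rewrite mulN1r addNr.
  have [d d0 Hd] := (has_deriv_withinP _ _ _ _).1 dzr e e0.
  pose s := Num.min (tau + d / 2) xi.
  have taus : tau < s by rewrite lt_min tauxi andbT ltrDl divr_gt0.
  have sxi : s <= xi by rewrite ge_min lexx orbT.
  have sd : s - tau < d.
    rewrite ltrBlDl; apply: (@le_lt_trans _ _ (tau + d / 2)).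
      by rewrite ge_min lexx.
    by rewrite ltrD2l ltr_pdivrMr// ltr_pMr// ltr1n.
  have s_c : s <= c by rewrite (le_trans sxi)// (le_trans (ltW xim)).
  have [eta /andP[taueta etas] zs] : exists2 eta, tau < eta < s & z s = g eta * (s - tau).
    by apply: mvt; rewrite taus.
  have s_tau : 0 < s - tau by rewrite subr_gt0.
  have geta : `|g eta| <= e.
    rewrite -(ler_pM2r s_tau) -[X in _ * X <= _](gtr0_norm s_tau) -normrM -zs.
    rewrite -[X in _ <= _ * X](gtr0_norm s_tau).
    have := Hd s; rewrite mul0r subr0 {2}/z x12 mulN1r addNr subr0; apply.
      by rewrite /= in_itv/= ltW//= (le_trans s_c)// (le_trans (ltW csigma)).
    by rewrite gtr0_norm.
  have etaxi : eta <= xi by rewrite (le_trans (ltW etas)).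
  have in_ts r : eta <= r <= xi -> tau < r < sigma.
    move=> /andP[er rx]; rewrite (lt_le_trans taueta)//=.
    by rewrite (le_lt_trans rx)// (lt_trans xim)// (le_lt_trans mc).
  have imu : L1_fun T (fun t => M * al t + cst 0 t) by exact: L1_lin (L1_cst0 T).
  have xiT : xi <= T by rewrite (le_trans (ltW xim))// (le_trans mc)// (le_trans (ltW csigma)).
  have eta0 : 0 <= eta by rewrite (le_trans tau0)// ltW.
  have : `|g xi - g eta| <= prim (fun t => M * al t + cst 0 t) xi - prim (fun t => M * al t + cst 0 t) eta.
    apply: (abs_cont_increment_le imu) => //.
      apply: (@abs_cont_subset _ `]tau, sigma[%classic).
        by move=> r /=; rewrite !in_itv/=; exact: in_ts.
      exact: abs_cont_lin.
    have fae := ae_filter_ringOfSetsType (@completed_lebesgue_measure R).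
    apply: (@filterS3 _ _ fae _ _ _ _ _ ae1 ae2 flip) => r e1 e2 fl.
    rewrite in_itv/= => rin; have rts := in_ts r rin.
    exists (-1 * f r (x2 r) + f r (x1 r)).
      have rc : r \in `[tau, c].
        rewrite in_itv/=; case/andP: rts => /ltW-> _ /=.
        by case/andP: rin => _ /le_trans; apply; exact: le_trans (ltW xim) mc.
      rewrite mulN1r addrC addr0; apply: le_trans (fl (sub r rc) _ _) _.
      rewrite mulrC; apply: (@le_trans _ _ (`|x1 r - x2 r| * al r)).
        by rewrite ler_wpM2l// ler_norm.
      by rewrite ler_wpM2r//; have := maxz r rc; rewrite /z mulN1r addrC.
    apply: (@has_deriv_within_subset _ `[0, T]%classic).
      exists 1 => // u /= + _; rewrite !in_itv/= => /andP[eu ux].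
      by rewrite (le_trans eta0)//= (le_trans ux).
    exact: has_deriv_within_lin (e2 rts) (e1 rts).
  rewrite !(prim_lin (T := T))// ?eta0 ?xiT ?(le_trans eta0)// ?(le_trans etaxi)//; try exact: L1_cst0.
  rewrite !prim_cst0 !addr0 -mulrBr => dg.
  have dA : prim al xi - prim al eta <= A.
    have p1 : prim al xi <= A by apply: (prim_ge0 ial) => //; rewrite (le_trans eta0).
    have p2 : 0 <= prim al eta.
      by rewrite -(prim_at0 al); apply: (prim_ge0 ial) => //; rewrite (le_trans etaxi).
    by apply: le_trans p1; rewrite gerBl.
  have : `|g xi| <= `|g eta| + `|g xi - g eta|.
    by rewrite (le_trans _ (ler_normD _ _))// addrC subrK.
  move=> /le_trans; apply; rewrite addrC; apply: lerD geta.
  by apply: le_trans dg _; exact: ler_wpM2l.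
have [xi xim zm] : exists2 xi, tau < xi < m & z m = g xi * (m - tau).
  by apply: mvt; rewrite ltm.
have m_tau : 0 < m - tau by rewrite subr_gt0.
have Mle : M <= M * A * (m - tau).
  apply/ler_addgt0Pr => e e0.
  have e'0 : 0 < e / (m - tau) by rewrite divr_gt0.
  have := gle _ _ e'0 xim; rewrite -(ler_pM2r m_tau) -[X in `|_| * X](gtr0_norm m_tau).
  by rewrite -normrM -zm -/M mulrDl divfK// gt_eqF.
have [//|Mpos] := leP M 0.
have : M * ((m - tau) * A) < M * 1.
  rewrite ltr_pM2l//; apply: le_lt_trans cA.
  by rewrite ler_wpM2r// lerD2r.
by rewrite mulr1 ltNge (le_trans Mle)// -mulrA [A * _]mulrC.
Qed.

(** A nonzero velocity after an impact takes the solution off the wall; it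
    cannot cross to the other wall at once, and leaving the strip is excluded. *)
Lemma leaves_wall (R : realType) (a T r l : R) (x : R -> R) : 0 < a ->
  0 <= r -> (forall t, 0 <= t <= T -> - a <= x t <= a) ->
  `|x r| = a -> l != 0 -> has_deriv_within `[r, T] x r l ->
  exists2 d, 0 < d & forall t, r < t < r + d -> t <= T -> `|x t| < a.
Proof.
move=> a0 r0 xa xr l0 /has_deriv_withinP H.
have nl : 0 < `|l| by rewrite normr_gt0.
have nl2 : 0 < `|l| / 2 by rewrite divr_gt0.
have [d d0 Hd] := H _ nl2.
exists (Num.min d (a / `|l|)); first by rewrite lt_min d0 divr_gt0.
move=> t /andP[rt]; rewrite -ltrBlDl lt_min => /andP[td ta] tT.
have tr0 : 0 < t - r by rewrite subr_gt0.
have rtT : `[r, T]%classic t by rewrite /= in_itv/= ltW.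
have := Hd t rtT; rewrite [`|t - r|]gtr0_norm// => /(_ td) xt.
have lt_a : `|l| * (t - r) < a by rewrite mulrC -ltr_pdivlMr.
have lt_0 : 0 < `|l| * (t - r) by rewrite mulr_gt0.
have n1 : `|l * (t - r)| = `|l| * (t - r) by rewrite normrM (gtr0_norm tr0).
have /andP[ax xa'] : - a <= x t <= a by rewrite xa// tT (le_trans r0 (ltW rt)).
have ub : `|x t - x r| <= `|x t - x r - l * (t - r)| + `|l * (t - r)|.
  by rewrite -[X in `|X| <= _](subrK (l * (t - r))) ler_normD.
have lb : `|l * (t - r)| <= `|x t - x r| + `|x t - x r - l * (t - r)|.
  rewrite (le_trans _ (ler_normB _ _))//.
  by rewrite (_ : _ - _ - (_ - _ - _) = l * (t - r))//; ring.
rewrite lt_neqAle ler_norml ax xa' /= andbT.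
apply/negP => /eqP xta.
have : x t = x r \/ x t = - x r.
  move: xta xr; case: (ger0P (x t)) => _; case: (ger0P (x r)) => _ h1 h2;
    [left|right|right|left]; lra.
move=> [E|E].
  by move: lb; rewrite E subrr normr0 add0r; move: xt; rewrite E subrr; lra.
have : `|x t - x r| = a + a.
  by rewrite E -opprD normrN -mulr2n -mulr_natr normrM xr normr_nat mulr_natr mulr2n.
lra.
Qed.

Lemma continuous_below (R : realType) (a T r : R) (x : R -> R) :
  {within `[0, T], continuous x} -> 0 <= r <= T -> `|x r| < a ->
  exists2 d, 0 < d & forall t, 0 <= t <= T -> `|t - r| < d -> `|x t| < a.
Proof.
move=> /within_continuousP cx rT xr.
have e0 : 0 < (a - `|x r|) / 2 by rewrite divr_gt0// subr_gt0.
have [|d d0 Hd] := cx r _ _ e0; first by rewrite /= in_itv.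
exists d => // t tT td.
have := Hd t; rewrite /= in_itv/= => /(_ tT td) H.
have : `|x t| <= `|x t - x r| + `|x r|.
  by rewrite -[X in `|X| <= _](subrK (x r)) ler_normD.
lra.
Qed.

(** Solutions are compared by [real_induction]. The velocities that two
    solutions have on arriving at a time are determined by their common past;
    the impulse condition then determines the velocities on leaving, also at an
    impact, and a nonzero one brings both back to where [unique_right]
    applies. *)
Lemma cauchy_unique (R : realType) (a T v : R) (f : R -> R -> R) (alpha x1 x2 : R -> R) :
  0 < a -> 0 <= T -> L1_fun T alpha ->
  {ae leb, forall t : lebesgueR R, t \in `[0, T] ->
     forall x y : R, `|f t x - f t y| <= alpha t * `|x - y|} ->
  cauchy_solution a T f v x1 -> cauchy_solution a T f v x2 ->
  (forall s l, 0 < s < T -> `|x1 s| = a -> has_deriv_within `[0, s] x1 s l -> l != 0) ->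
  forall t, 0 <= t <= T -> x1 t = x2 t.
Proof.
move=> a0 T0 ial flip [[cx1 xa1 [g1 [dg1 ac1 ae1]] im1] x10 dv1].
move=> [[cx2 xa2 [g2 [dg2 ac2 ae2]] im2] x20 dv2] nz t /andP[t0 tT].
apply: (@real_induction _ 0 t (fun u => x1 u = x2 u)) => // r /andP[r0 rt] eqr.
have rT : 0 <= r <= T by rewrite r0 (le_trans rt).
have acc d : 0 < r -> 0 < d -> exists s, [/\ `[0, r]%classic s, s != r & `|s - r| < d].
  exact: itv_near_right_end.
have accT d : r < T -> 0 < d -> exists s, [/\ `[r, T]%classic s, s != r & `|s - r| < d].
  exact: itv_near_left_end.
have x12 : x1 r = x2 r.
  move: r0; rewrite le_eqVlt => /predU1P[<-|r_gt0]; first by rewrite x10 x20.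
  apply/eqP; rewrite -subr_eq0 -normr_le0; apply/ler_addgt0Pr => e e0; rewrite add0r.
  have e20 : 0 < e / 2 by rewrite divr_gt0.
  have rin : `[0, T]%classic r by rewrite /= in_itv.
  have [d1 d10 H1] := (within_continuousP _ _).1 cx1 r rin _ e20.
  have [d2 d20 H2] := (within_continuousP _ _).1 cx2 r rin _ e20.
  have [|s [sr0 sr]] := acc (Num.min d1 d2) r_gt0; first by rewrite lt_min d10.
  rewrite lt_min => /andP[sd1 sd2]; move: sr0; rewrite /= in_itv/= => /andP[s0 s_r].
  have sin : `[0, T]%classic s by rewrite /= in_itv/= s0 (le_trans s_r)//; case/andP: rT.
  have := H1 s sin sd1; have := H2 s sin sd2; rewrite (eqr s) ?s0 ?lt_neqAle ?sr// => h2 h1.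
  have : `|x1 r - x2 r| <= `|x2 s - x2 r| + `|x2 s - x1 r|.
    rewrite (le_trans _ (ler_normB _ _))//.
    by rewrite (_ : _ - _ - (_ - _) = x1 r - x2 r)//; ring.
  lra.
have [rT'|Tr] := ltP r T; last first.
  exists 1 => // v' /andP[rv _] vt.
  by rewrite (_ : v' = r)//; apply/eqP; rewrite eq_le rv (le_trans vt)// (le_trans tT).
suff [l [dl1 dl2 [d d0 Hd]]] : exists l, [/\ has_deriv_within `[r, T] x1 r l,
    has_deriv_within `[r, T] x2 r l & exists2 d, 0 < d &
      forall s, r < s < r + d -> s <= T -> `|x1 s| < a /\ `|x2 s| < a].
  pose sigma := Num.min T (r + d).
  have rsigma : r < sigma by rewrite lt_min rT' ltrDl.
  have sigmaT : sigma <= T by rewrite ge_min lexx.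
  have in_s s : r < s < sigma -> [/\ 0 <= s <= T, `|x1 s| < a & `|x2 s| < a].
    move=> /andP[rs ss]; have sT : s <= T by rewrite (le_trans (ltW ss)).
    have [||//] := Hd s; last by split=> //; rewrite sT (le_trans r0 (ltW rs)).
      by rewrite rs (lt_le_trans ss)// ge_min lexx orbT.
    by [].
  have [d' d'0 eq'] : exists2 d', 0 < d' & forall u, r <= u < r + d' -> x1 u = x2 u.
    apply: (@unique_right _ T r sigma l alpha f x1 x2 g1 g2) => //.
    - by move=> s /in_s[? ? _]; exact: dg1.
    - by move=> s /in_s[? _ ?]; exact: dg2.
    - apply: ac1 => [|u /=]; last by rewrite in_itv/= => /in_s[].
      exact: interval_is_interval.
    - apply: ac2 => [|u /=]; last by rewrite in_itv/= => /in_s[].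
      exact: interval_is_interval.
    - by apply: filterS ae1 => s H /in_s[? ? _]; apply: H; rewrite // in_itv.
    - by apply: filterS ae2 => s H /in_s[? _ ?]; apply: H; rewrite // in_itv.
  by exists d' => // v' rv' _; exact: eq'.
have toL (x : R -> R) (l : R) : has_deriv_within `[0, T] x r l -> has_deriv_within `[0, r] x r l.
  apply: has_deriv_within_subset; exists 1 => // s /=; rewrite !in_itv/= => /andP[-> sr] _.
  by rewrite (le_trans sr)//; case/andP: rT.
have toR (x : R -> R) (l : R) : has_deriv_within `[0, T] x r l -> has_deriv_within `[r, T] x r l.
  apply: has_deriv_within_subset; exists 1 => // s /=; rewrite !in_itv/= => /andP[rs ->] _.
  by rewrite (le_trans r0).
have past (l : R) : has_deriv_within `[0, r] x1 r l -> has_deriv_within `[0, r] x2 r l.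
  apply: has_deriv_within_eq => //; exists 1 => // s /=; rewrite in_itv/= => /andP[s0 sr] _.
  by have [->//|nsr] := eqVneq s r; apply: eqr; rewrite s0 lt_neqAle nsr.
have [xr|ar] := ltP `|x1 r| a.
  have xr2 : `|x2 r| < a by rewrite -x12.
  have g12 : g1 r = g2 r.
    move: r0; rewrite le_eqVlt => /predU1P[rE|r_gt0].
      have u1 : g1 r = v.
        apply: (@has_deriv_within_unique _ _ x1 _ _ _ (accT^~ rT')); first by apply: toR; exact: dg1.
        by apply: toR; rewrite -rE.
      rewrite u1; apply: (@has_deriv_within_unique _ _ x2 _ _ _ (accT^~ rT')); first by apply: toR; rewrite -rE.
      by apply: toR; exact: dg2.
    apply: (@has_deriv_within_unique _ _ x2 _ _ _ (acc^~ r_gt0)); last by apply: toL; exact: dg2.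
    by apply: past; apply: toL; exact: dg1.
  exists (g1 r); split; first by apply: toR; exact: dg1.
    by rewrite g12; apply: toR; exact: dg2.
  have [d1 d10 H1] := continuous_below cx1 rT xr.
  have [d2 d20 H2] := continuous_below cx2 rT xr2.
  exists (Num.min d1 d2); first by rewrite lt_min d10.
  move=> s /andP[rs]; rewrite -ltrBlDl lt_min => /andP[sd1 sd2] sT.
  have n : `|s - r| = s - r by rewrite gtr0_norm// subr_gt0.
  by split; [apply: H1|apply: H2]; rewrite ?n// sT (le_trans r0 (ltW rs)).
have xr1 : `|x1 r| = a by apply/eqP; rewrite eq_le ar andbT ler_norml; exact: xa1.
have xr2 : `|x2 r| = a by rewrite -x12.
have r_gt0 : 0 < r.
  rewrite lt_neqAle r0 andbT; apply: contraTneq a0 => rE.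
  by rewrite -xr1 -rE x10 normr0 ltxx.
have rin : 0 < r < T by rewrite r_gt0.
have [l1 [L1 R1]] := im1 r rin xr1; have [l2 [L2 R2]] := im2 r rin xr2.
have l12 : l1 = l2.
  by apply: (has_deriv_within_unique (acc^~ r_gt0)) L2; exact: past.
have l0 : - l1 != 0 by rewrite oppr_eq0; exact: nz L1.
exists (- l1); split; rewrite // ?l12//.
have [d1 d10 H1] := leaves_wall a0 r0 xa1 xr1 l0 R1.
have [d2 d20 H2] : exists2 d, 0 < d & forall t, r < t < r + d -> t <= T -> `|x2 t| < a.
  by apply: (leaves_wall a0 r0 xa2 xr2 l0); rewrite l12.
exists (Num.min d1 d2); first by rewrite lt_min d10.
move=> s /andP[rs]; rewrite -ltrBlDl lt_min !ltrBlDl => /andP[sd1 sd2] sT.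
by split; [apply: H1|apply: H2]; rewrite ?rs.
Qed.

(** * Folding and unfolding *)

(** The strip of the unfolded line to which [y] belongs: the number of impacts
    that a ball leaving [0] to the right has had on reaching [y]. *)
Definition branch (R : realType) (a y : R) : nat := Num.truncn ((y + a) / (2 * a)).

(** The triangle wave of period [4 * a]: it folds the half-line to the right of
    [- a] onto the strip between [- a] and [a]. *)
Definition fold (R : realType) (a y : R) : R :=
  (-1) ^+ branch a y * (y - 2 * a * (branch a y)%:R).

Lemma branch_lt (R : realType) (a y : R) : 0 < a ->
  y < 2 * a * (branch a y)%:R + a.
Proof.
move=> a0; have a20 : 0 < 2 * a by rewrite mulr_gt0.
have := truncnS_gt ((y + a) / (2 * a)); rewrite ltr_pdivrMr// -/(branch a y) -natr1.
by move=> ?; lra.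
Qed.

Lemma branch_le (R : realType) (a y : R) : 0 < a -> - a <= y ->
  2 * a * (branch a y)%:R - a <= y.
Proof.
move=> a0 ay; have a20 : 0 < 2 * a by rewrite mulr_gt0.
have y0 : 0 <= (y + a) / (2 * a) by rewrite divr_ge0 ?(ltW a20)//; lra.
have := truncn_itv y0 => /andP[+ _]; rewrite ler_pdivlMr// -/(branch a y).
by move=> ?; lra.
Qed.

Lemma branch_eq (R : realType) (a y : R) (n : nat) : 0 < a ->
  2 * a * n%:R - a <= y < 2 * a * n%:R + a -> branch a y = n.
Proof.
move=> a0 /andP[ly yl]; have a20 : 0 < 2 * a by rewrite mulr_gt0.
apply/eqP; rewrite truncn_eq; last first.
  rewrite divr_ge0 ?(ltW a20)//; have : 0 <= 2 * a * n%:R by rewrite mulr_ge0// ltW.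
  lra.
by rewrite ler_pdivlMr// ltr_pdivrMr// -natr1; apply/andP; split; lra.
Qed.

Lemma branch_mono (R : realType) (a y z : R) : 0 < a -> y <= z ->
  (branch a y <= branch a z)%N.
Proof.
move=> a0 yz; apply: le_truncn.
by rewrite ler_pM2r ?invr_gt0 ?mulr_gt0// lerD2r.
Qed.

Lemma fold_on (R : realType) (a y : R) (n : nat) : 0 < a ->
  2 * a * n%:R - a <= y <= 2 * a * n%:R + a ->
  fold a y = (-1) ^+ n * (y - 2 * a * n%:R).
Proof.
move=> a0 /andP[ly]; rewrite le_eqVlt => /predU1P[->|yl].
  rewrite /fold (@branch_eq _ _ _ n.+1)//; first by rewrite exprS -natr1; ring.
  by rewrite -natr1; apply/andP; split; lra.
by rewrite /fold (@branch_eq _ _ _ n)// ly.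
Qed.

(** Within a strip folding is an isometry. From strip [n] to a later strip [k]
    the graph turns back at least once, and twice if [n] and [k] have the same
    parity, which leaves a linear inequality for each choice of the signs. *)
Lemma fold_lip (R : realType) (a y z : R) : 0 < a ->
  `|fold a y - fold a z| <= `|y - z|.
Proof.
move=> a0; wlog yz : y z / y <= z => [wl|].
  by have [/wl//|/ltW/wl] := leP y z; rewrite distrC [X in _ <= X -> _]distrC.
have := branch_mono a0 yz; rewrite leq_eqVlt => /predU1P[E|].
  rewrite /fold E -mulrBr normrM normrX normrN1 expr1n mul1r.
  by rewrite (_ : _ - _ - _ = y - z)//; ring.
have zu := branch_lt z a0; have yu := branch_lt y a0.
rewrite /fold; set n := branch a y in yu *; set k := branch a z in zu *.
move=> nk; have k0 : (0 < k)%N by apply: leq_ltn_trans nk.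
have za : - a <= z.
  by move: k0; rewrite truncn_gt0 ler_pdivlMr ?mulr_gt0//; lra.
have zl := branch_le a0 za; rewrite -/k in zl.
have nkR : n%:R + 1 <= k%:R :> R by rewrite natr1 ler_nat.
have nkR2 : odd n = odd k -> n%:R + 2 <= k%:R :> R.
  move=> par; rewrite -natrD ler_nat addn2 ltn_neqAle nk andbT.
  by apply/eqP => E; move: par; rewrite -E/=; case: (odd n).
have anR : a * (n%:R + 1) <= a * k%:R by rewrite ler_pM2l.
have anR2 : odd n = odd k -> a * (n%:R + 2) <= a * k%:R by move=> /nkR2; rewrite ler_pM2l.
rewrite -signr_odd -[(-1) ^+ k]signr_odd.
rewrite [X in _ <= X]ler0_norm ?subr_le0// ler_norml.
by case: (odd n) (odd k) anR2 => [] [] => [/(_ erefl) ?| _| _|/(_ erefl) ?];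
  rewrite /= ?expr0 ?expr1; apply/andP; split; lra.
Qed.

Lemma fold_continuous (R : realType) (a : R) : 0 < a -> continuous (fold a).
Proof.
move=> a0 y; apply/cvgrPdist_le => e e0; apply/nbhs_ballP; exists e => //= z.
by rewrite /ball/= => /ltW; apply: le_trans; exact: fold_lip.
Qed.

Lemma fold_itv (R : realType) (a y : R) : 0 < a -> 0 <= y -> - a <= fold a y <= a.
Proof.
move=> a0 y0; have ay : - a <= y by lra.
have := branch_lt y a0; have := branch_le a0 ay; rewrite /fold -signr_odd.
by case: odd; rewrite /= ?expr0 ?expr1 => ? ?; apply/andP; split; lra.
Qed.

Lemma norm_fold (R : realType) (a y : R) :
  `|fold a y| = `|y - 2 * a * (branch a y)%:R|.
Proof. by rewrite /fold normrM normrX normrN1 expr1n mul1r. Qed.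

Lemma fold_wall (R : realType) (a : R) (n : nat) : 0 < a ->
  fold a (2 * a * n%:R + a) = (-1) ^+ n * a.
Proof. by move=> a0; rewrite (@fold_on _ _ _ n)//; [congr (_ * _); ring|apply/andP; split; lra]. Qed.

Lemma fold_wallP (R : realType) (a y : R) : 0 < a -> 0 <= y -> `|fold a y| = a ->
  exists n : nat, y = 2 * a * n%:R + a /\ branch a y = n.+1.
Proof.
move=> a0 y0; have ay : - a <= y by lra.
have yl := branch_le a0 ay; have yu := branch_lt y a0.
rewrite norm_fold; case: (branch a y) yl yu => [|n] yl yu ya.
  by exfalso; move: ya yu; rewrite mulr0 subr0 ger0_norm// add0r; lra.
exists n; split=> //; move: ya yl yu; rewrite -natr1; set c := 2 * a * _.
by case: (ger0P (y - c)) => _; rewrite /c; lra.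
Qed.

(** A motion [y], with velocity [p], of the ball in the unfolded strip, where an
    impact is a passage through an odd multiple of [a] and the velocity does not
    jump. *)
Definition unfolded_solution (R : realType) (a T : R) (f : R -> R -> R) (v : R)
    (y p : R -> R) : Prop :=
  [/\ y 0 = 0, p 0 = v,
      (forall t, 0 <= t <= T -> 0 < p t /\ has_deriv_within `[0, T] y t (p t)),
      absolutely_continuous_on `[0, T] p &
      {ae leb, forall t : lebesgueR R, t \in `[0, T] ->
         has_deriv_within `[0, T] p t ((-1) ^+ branch a (y t) * f t (fold a (y t)))}].

Lemma has_deriv_within_fold (R : realType) (a t l : R) (n : nat) (D : set R) (y : R -> R) :
  0 < a -> 2 * a * n%:R - a <= y t <= 2 * a * n%:R + a ->
  (exists2 d, 0 < d & forall s, D s -> `|s - t| < d ->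
     2 * a * n%:R - a <= y s <= 2 * a * n%:R + a) ->
  has_deriv_within D y t l -> has_deriv_within D (fold a \o y) t ((-1) ^+ n * l).
Proof.
move=> a0 yt [d d0 ys] dy.
have := @has_deriv_within_lin _ D y (cst (- (-1) ^+ n * (2 * a * n%:R))) ((-1) ^+ n)
  t l 0 dy (@has_deriv_within_cst _ _ _ _).
rewrite addr0; apply: has_deriv_within_eq => [|/=].
  by exists d => // s Ds sd; rewrite /= (fold_on a0 (ys s Ds sd)); ring.
by rewrite (fold_on a0 yt); ring.
Qed.

Lemma has_deriv_pos_increasing (R : realType) (T : R) (y p : R -> R) :
  (forall t, 0 <= t <= T -> 0 < p t /\ has_deriv_within `[0, T] y t (p t)) ->
  {within `[0, T], continuous y} /\
  forall s t, 0 <= s -> s < t -> t <= T -> y s < y t.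
Proof.
move=> dy; have cy : {within `[0, T], continuous y}.
  apply: has_deriv_within_continuous => t; rewrite /= in_itv/= => /dy[_ ?].
  by exists (p t).
split=> // s t s0 st tT.
have [xi||xi] := @MVT _ y p s t st.
- rewrite in_itv/= => /andP[sxi xit].
  have /dy[_] : 0 <= xi <= T by rewrite (le_trans s0 (ltW sxi)) (le_trans (ltW xit)).
  by apply: has_deriv_within_is_derive; rewrite (le_lt_trans s0)// (lt_le_trans xit).
- by apply: continuous_subspaceW cy; apply: subset_itv; rewrite bnd_simp.
- rewrite in_itv/= => /andP[sxi xit] E; rewrite -subr_gt0 E mulr_gt0 ?subr_gt0//.
  have /dy[] : 0 <= xi <= T by rewrite (le_trans s0 (ltW sxi)) (le_trans (ltW xit)).
  by [].
Qed.

Lemma unfolded_increasing (R : realType) (a T v : R) (f : R -> R -> R) (y p : R -> R) :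
  unfolded_solution a T f v y p ->
  {within `[0, T], continuous y} /\
  forall s t, 0 <= s -> s < t -> t <= T -> y s < y t.
Proof. by move=> [_ _ dy _ _]; exact: has_deriv_pos_increasing dy. Qed.

(** Between impacts folding multiplies by a sign, so the equation is preserved;
    at an odd multiple of [a] the sign changes, which is the reversal of the
    velocity. *)
Lemma fold_unfolded (R : realType) (a T v : R) (f : R -> R -> R) (y p : R -> R) :
  0 < a -> 0 < T -> unfolded_solution a T f v y p ->
  cauchy_solution a T f v (fold a \o y) /\
  forall s l, 0 < s < T -> `|fold a (y s)| = a ->
    has_deriv_within `[0, s] (fold a \o y) s l -> l != 0.
Proof.
move=> a0 T0 U; have [cy incy] := unfolded_increasing U.
move: U => [y0 p0 dy acp aep].
have y_ge0 t : 0 <= t <= T -> 0 <= y t.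
  move=> /andP[]; rewrite le_eqVlt => /predU1P[<-|t0] tT; first by rewrite y0.
  by rewrite -y0 ltW// incy.
have ycont t d : 0 <= t <= T -> 0 < d -> exists2 d', 0 < d' &
    forall s, 0 <= s <= T -> `|s - t| < d' -> `|y s - y t| <= d.
  move=> tT d0; have [|d' d'0 H] := (within_continuousP _ _).1 cy t _ _ d0.
    by rewrite /= in_itv.
  by exists d' => // s sT; apply: H; rewrite /= in_itv.
have inside t : 0 <= t <= T -> `|fold a (y t)| < a ->
    let n := branch a (y t) in
    exists2 d, 0 < d & forall s, 0 <= s <= T -> `|s - t| < d ->
      2 * a * n%:R - a < y s < 2 * a * n%:R + a.
  move=> tT; rewrite norm_fold => ya n; rewrite -/n in ya.
  have d0 : 0 < (a - `|y t - 2 * a * n%:R|) / 2 by rewrite divr_gt0// subr_gt0.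
  have [d' d'0 H] := ycont t _ tT d0; exists d' => // s sT st.
  have := H s sT st; have := ya; rewrite ltr_norml => /andP[? ?].
  have := ler_norm (y t - 2 * a * n%:R).
  have := lerNnormlW (lexx `|y t - 2 * a * n%:R|).
  by rewrite ler_norml => ? ? /andP[? ?]; apply/andP; split; lra.
have dfold t : 0 <= t <= T -> `|fold a (y t)| < a ->
    has_deriv_within `[0, T] (fold a \o y) t ((-1) ^+ branch a (y t) * p t).
  move=> tT ya; have [d d0 H] := inside t tT ya; have [_ dyt] := dy t tT.
  have weak s : 2 * a * (branch a (y t))%:R - a < y s < 2 * a * (branch a (y t))%:R + a ->
      2 * a * (branch a (y t))%:R - a <= y s <= 2 * a * (branch a (y t))%:R + a.
    by move=> /andP[/ltW-> /ltW->].
  apply: has_deriv_within_fold dyt => //.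
    by apply: weak; apply: H => //; rewrite subrr normr0.
  by exists d => // s; rewrite /= in_itv/= => sT st; apply: weak; exact: H.
have left_deriv s n : 0 < s <= T -> y s = 2 * a * n%:R + a ->
    has_deriv_within `[0, s] (fold a \o y) s ((-1) ^+ n * p s).
  move=> /andP[s0 sT] ys; have sT' : 0 <= s <= T by rewrite ltW.
  have [d d0 H] := ycont s (2 * a) sT' (mulr_gt0 (ltr0n _ 2) a0).
  have [_ dys] := dy s sT'.
  apply: has_deriv_within_fold => //.
  - by rewrite ys; apply/andP; split; lra.
  - exists d => // r; rewrite /= in_itv/= => /andP[r0 rs] rd.
    have rT : 0 <= r <= T by rewrite r0 (le_trans rs).
    have := H r rT rd; rewrite ys ler_norml => /andP[? _]; apply/andP; split; first lra.
    move: rs; rewrite le_eqVlt => /predU1P[->|rs]; first by rewrite ys.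
    by rewrite -ys ltW// incy.
  - apply: has_deriv_within_subset dys; exists 1 => // r /=; rewrite !in_itv/=.
    by move=> /andP[-> rs] _; rewrite (le_trans rs).
have right_deriv s n : 0 <= s < T -> y s = 2 * a * n%:R + a ->
    has_deriv_within `[s, T] (fold a \o y) s (- ((-1) ^+ n * p s)).
  move=> /andP[s0 sT] ys; have sT' : 0 <= s <= T by rewrite s0 ltW.
  have [d d0 H] := ycont s (2 * a) sT' (mulr_gt0 (ltr0n _ 2) a0).
  have [_ dys] := dy s sT'.
  rewrite -mulNr -[- _]mulN1r -exprS; apply: has_deriv_within_fold => //.
  - by rewrite ys -natr1; apply/andP; split; lra.
  - exists d => // r; rewrite /= in_itv/= => /andP[sr rT] rd.
    have rT' : 0 <= r <= T by rewrite rT (le_trans s0).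
    have := H r rT' rd; rewrite ys ler_norml -natr1 => /andP[_ ?]; apply/andP; split; last lra.
    have : y s <= y r.
      move: sr; rewrite le_eqVlt => /predU1P[<-//|sr].
      by rewrite ltW// incy.
    rewrite ys; lra.
  - apply: has_deriv_within_subset dys; exists 1 => // r /=; rewrite !in_itv/=.
    by move=> /andP[sr ->] _; rewrite (le_trans s0).
have T0' : 0 <= (0 : R) <= T by rewrite lexx ltW.
have br0 : branch a 0 = 0%N by apply: branch_eq => //; rewrite mulr0; apply/andP; split; lra.
have fold0 : fold a 0 = 0 by rewrite /fold br0 mulr0 subr0 mulr0.
split; last first.
  move=> s l /andP[s0 sT] ys dl.
  have sT' : 0 <= s <= T by rewrite !ltW.
  have [n [yn _]] := fold_wallP a0 (y_ge0 s sT') ys.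
  have [ps _] := dy s sT'.
  have -> : l = (-1) ^+ n * p s.
    apply: (@has_deriv_within_unique _ `[0, s]%classic (fold a \o y) s) => //.
      by move=> d; exact: itv_near_right_end.
    by apply: left_deriv => //; rewrite s0 ltW.
  by rewrite mulf_eq0 signr_eq0 gt_eqF.
split; last 2 first.
- by rewrite /= y0 fold0.
- have := dfold 0 T0'; rewrite y0 fold0 normr0 br0 expr0 mul1r p0; exact.
split.
- by apply: within_continuous_comp cy => z _; exact: fold_continuous.
- by move=> t tT; apply: fold_itv => //; exact: y_ge0.
- exists (fun t => (-1) ^+ branch a (y t) * p t); split=> //.
  + move=> I itvI sub.
    have brI s t : I s -> I t -> branch a (y s) = branch a (y t).
      wlog st : s t / s < t => [wl Is It|Is It].
        by case: (ltgtP s t) => [/wl->//|/wl->//|->].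
      have [sT ns] := sub s Is; have [tT nt] := sub t It.
      have [s0 _] := andP sT; have [_ t_T] := andP tT.
      have yst := incy s t s0 st t_T.
      apply/eqP; move: (branch_mono a0 (ltW yst)); rewrite leq_eqVlt => /predU1P[->//|nn].
      exfalso; have yt0 : - a <= y t by have := y_ge0 t tT; lra.
      have ub := branch_lt (y s) a0; have lb := branch_le a0 yt0.
      have nnR : (branch a (y s))%:R + 1 <= (branch a (y t))%:R :> R by rewrite natr1 ler_nat.
      have annR : a * ((branch a (y s))%:R + 1) <= a * (branch a (y t))%:R by rewrite ler_pM2l.
      have [||r] := @IVT _ y s t (2 * a * (branch a (y s))%:R + a) (ltW st).
      * by apply: continuous_subspaceW cy; apply: subset_itv; rewrite bnd_simp.
      * rewrite (min_l (ltW yst)) (max_r (ltW yst)); apply/andP; split; lra.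
      rewrite in_itv/= => /andP[sr rt] yr.
      have [_] := sub r (itvI s t Is It r (introT andP (conj sr rt))).
      by rewrite /= yr fold_wall// normrM normrX normrN1 expr1n mul1r gtr0_norm// ltxx.
    have [[t It]|I0] := pselect (exists t, I t); last first.
      move=> e e0; exists 1 => // n u w uw _ _; rewrite big1// => i _.
      by have [Iu _ _] := uw i; exfalso; apply: I0; exists (u i).
    apply: (@abs_cont_eq _ _ (fun s => (-1) ^+ branch a (y t) * p s)).
      by move=> s Is; rewrite (brI s t Is It).
    apply: abs_cont_scale; apply: abs_cont_subset acp.
    by move=> s /sub[sT _]; rewrite /= in_itv.
  + apply: filterS aep => t H tT yt; have := H tT => {}H.
    move: (tT); rewrite in_itv/= => tT'.
    have [d d0 Hd] := inside t tT' yt.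
    have := @has_deriv_within_lin _ _ _ (cst 0) ((-1) ^+ branch a (y t)) _ _ 0 H
      (@has_deriv_within_cst _ _ _ _).
    rewrite addr0 mulrA -expr2 sqrr_sign mul1r.
    apply: has_deriv_within_eq => [|/=]; last by rewrite addr0.
    exists d => // s; rewrite /= in_itv/= => sT st.
    by rewrite addr0 (branch_eq a0 (n := branch a (y t)))//;
      have /andP[/ltW-> ->] := Hd s sT st.
- move=> s /andP[s0 sT] ys; have sT' : 0 <= s <= T by rewrite !ltW.
  have [n [yn _]] := fold_wallP a0 (y_ge0 s sT') ys.
  exists ((-1) ^+ n * p s); split; first by apply: left_deriv => //; rewrite s0 ltW.
  by apply: right_deriv => //; rewrite ltW.
Qed.

(** A motion that goes further has passed, at different times, one more wall
    than [ts] has elements. *)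
Lemma unfolded_impacts_lt (R : realType) (a T v : R) (f : R -> R -> R) (y p : R -> R)
    (ts : seq R) :
  0 < a -> 0 < T -> unfolded_solution a T f v y p ->
  impact_times a T (fold a \o y) `<=` [set s | s \in ts] ->
  y T < 2 * a * (size ts)%:R + a.
Proof.
move=> a0 T0 U its; have [cy incy] := unfolded_increasing U; have [y0 _ _ _ _] := U.
rewrite ltNge; apply/negP => yT.
have cross (i : 'I_(size ts).+1) : exists s, s \in ts /\ y s = 2 * a * i%:R + a.
  have ai : a * i%:R <= a * (size ts)%:R by rewrite ler_pM2l// ler_nat -ltnS.
  have a_i : 0 <= a * i%:R by rewrite mulr_ge0// ltW.
  have y0T : y 0 < y T by apply: incy.
  have [|s] := @IVT _ y 0 T (2 * a * i%:R + a) (ltW T0) cy.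
    rewrite (min_l (ltW y0T)) (max_r (ltW y0T)) y0; apply/andP; split; lra.
  rewrite in_itv/= => sT ys; exists s; split=> //; apply: its; split=> //.
  by rewrite /= ys fold_wall// normrM normrX normrN1 expr1n mul1r gtr0_norm.
have [s Hs] := choice cross.
have sinj : injective s.
  move=> i j sij; apply: val_inj => /=; apply/eqP; rewrite -(eqr_nat R).
  have [_ yi] := Hs i; have [_ yj] := Hs j; rewrite sij yj in yi.
  move/addIr: yi => /mulfI ->//.
  by rewrite mulf_neq0 ?gt_eqF.
have : (size [seq s i | i <- enum 'I_(size ts).+1] <= size ts)%N.
  apply: uniq_leq_size; first by rewrite map_inj_uniq ?enum_uniq.
  by move=> _ /mapP[i _ ->]; have [] := Hs i.
by rewrite size_map size_enum_ord ltnn.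
Qed.

(** Distinct impacts lead into distinct strips, and a motion that stops earlier
    enters too few of them. *)
Lemma unfolded_impacts_ge (R : realType) (a T v : R) (f : R -> R -> R) (y p : R -> R)
    (ss : seq R) (n : nat) :
  0 < a -> unfolded_solution a T f v y p -> uniq ss ->
  [set s | s \in ss] `<=` impact_times a T (fold a \o y) -> (n < size ss)%N ->
  2 * a * n%:R + a <= y T.
Proof.
move=> a0 U uss iss nss; have [cy incy] := unfolded_increasing U; have [y0 _ _ _ _] := U.
rewrite leNgt; apply/negP => yT.
have y_le s : 0 <= s <= T -> 0 <= y s <= y T.
  move=> /andP[s0 sT]; apply/andP; split.
    move: s0; rewrite le_eqVlt => /predU1P[<-|s0]; first by rewrite y0.
    by rewrite -y0 ltW// incy.
  move: sT; rewrite le_eqVlt => /predU1P[->//|sT].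
  by rewrite ltW// incy.
have num s : s \in ss -> exists2 i : nat, (i < n)%N & y s = 2 * a * i%:R + a.
  move=> /iss[sT ys]; have /andP[ys0 ysT] := y_le s sT.
  have [i [yi _]] := fold_wallP a0 ys0 ys; exists i => //.
  rewrite -(ltr_nat R); have : 2 * a * i%:R < 2 * a * n%:R by lra.
  by rewrite ltr_pM2l// mulr_gt0.
have inj : {in ss &, injective (fun s => branch a (y s))}.
  move=> s t sin tin; have [i _ ys] := num s sin; have [j _ yt] := num t tin.
  have wall k : branch a (2 * a * k%:R + a) = k.+1.
    by apply: branch_eq => //; rewrite -natr1; apply/andP; split; lra.
  rewrite /= ys yt !wall => -[ij].
  have {ij} yst : y s = y t by rewrite ys yt ij.
  have [/andP[s0 sT] _] := iss s sin; have [/andP[t0 tT] _] := iss t tin.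
  apply/eqP; rewrite eq_le !leNgt; apply/andP; split; apply/negP => lt_st.
    by have := incy t s t0 lt_st sT; rewrite yst ltxx.
  by have := incy s t s0 lt_st tT; rewrite yst ltxx.
have : (size [seq branch a (y s) | s <- ss] <= size (iota 1 n))%N.
  apply: uniq_leq_size; first by rewrite map_inj_in_uniq.
  move=> _ /mapP[s /num[i ltin ys] ->]; rewrite mem_iota ys.
  rewrite (@branch_eq _ _ _ i.+1)//; last by rewrite -natr1; apply/andP; split; lra.
by rewrite size_map size_iota leqNgt nss.
Qed.

(** * Euler's method for the unfolded motion *)

(** A difference quotient of [fold a]: a continuous substitute, bounded by [1],
    for the sign [(-1) ^+ branch a y], which jumps at the walls. *)
Definition slope (R : realType) (a : R) (N : nat) (y : R) : R :=
  (fold a (y + N.+1%:R^-1) - fold a y) * N.+1%:R.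

Lemma slope_le1 (R : realType) (a : R) (N : nat) (y : R) : 0 < a ->
  `|slope a N y| <= 1.
Proof.
move=> a0; rewrite normrM normr_nat -ler_pdivlMr ?ltr0n// div1r.
have := fold_lip (y + N.+1%:R^-1) y a0.
by rewrite [y + _]addrC addrK [X in _ <= X]gtr0_norm// invr_gt0 ltr0n.
Qed.

Lemma slope_continuous (R : realType) (a : R) (N : nat) : 0 < a ->
  continuous (slope a N).
Proof.
move=> a0 y; apply: cvgMr_tmp; apply: cvgB; last exact: fold_continuous.
apply: continuous_cvg; first exact: fold_continuous.
by apply: cvgD; [exact: cvg_id|exact: cvg_cst].
Qed.

Definition grid (R : realType) (T : R) (N i : nat) : R := i%:R * (T / N.+1%:R).

Definition grid_index (R : realType) (T : R) (N : nat) (t : R) : nat :=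
  Num.truncn (t / (T / N.+1%:R)).

(** Position and velocity after [i] steps of Euler's method. The field is frozen
    in the position only: its dependence on time is integrated. *)
Fixpoint euler (R : realType) (a T : R) (f : R -> R -> R) (N : nat) (lam : R)
    (i : nat) : R * R :=
  if i is j.+1 then
    let: (y, p) := euler a T f N lam j in
    (y + T / N.+1%:R * p,
     p + slope a N y * (prim (f ^~ (fold a y)) (grid T N j.+1)
                        - prim (f ^~ (fold a y)) (grid T N j)))
  else (0, lam).

(** Written as a function of time, so that the Euler velocity is its primitive
    on the grid. *)
Definition euler_force (R : realType) (a T : R) (f : R -> R -> R) (N : nat)
    (lam t : R) : R :=
  let y := (euler a T f N lam (grid_index T N t)).1 in
  slope a N y * f t (fold a y).

Section Grid.
Variables (R : realType) (T : R) (N : nat).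
Hypothesis T0 : 0 < T.

Let step_gt0 : 0 < T / N.+1%:R.
Proof. by rewrite divr_gt0. Qed.

Lemma grid0 : grid T N 0 = 0.
Proof. by rewrite /grid mul0r. Qed.

Lemma gridS i : grid T N i.+1 = grid T N i + T / N.+1%:R.
Proof. by rewrite /grid -natr1 mulrDl mul1r. Qed.

Lemma grid_last : grid T N N.+1 = T.
Proof. by rewrite /grid mulrC divfK. Qed.

Lemma grid_le i j : (i <= j)%N -> grid T N i <= grid T N j.
Proof. by move=> ij; rewrite /grid ler_pM2r// ler_nat. Qed.

Lemma grid_itv i : (i <= N.+1)%N -> 0 <= grid T N i <= T.
Proof.
move=> iN; have := grid_le (leq0n i); have := grid_le iN.
by rewrite grid0 grid_last => -> ->.
Qed.

Lemma grid_index_itv t : 0 <= t ->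
  grid T N (grid_index T N t) <= t < grid T N (grid_index T N t) + T / N.+1%:R.
Proof.
move=> t0; have : 0 <= t / (T / N.+1%:R) by rewrite divr_ge0// ltW.
by move=> /truncn_itv; rewrite -/(grid_index T N t) -gridS /grid ler_pdivlMr// ltr_pdivrMr.
Qed.

Lemma grid_index_eq i t : grid T N i <= t < grid T N i + T / N.+1%:R ->
  grid_index T N t = i.
Proof.
rewrite -gridS /grid -ler_pdivlMr// -ltr_pdivrMr// => it.
apply/eqP; rewrite truncn_eq//; case/andP: it => + _; apply: le_trans.
exact: ler0n.
Qed.

Lemma grid_index_le t : 0 <= t <= T -> (grid_index T N t <= N.+1)%N.
Proof.
move=> /andP[t0 tT]; have /andP[it _] := grid_index_itv t0.
have : grid T N (grid_index T N t) <= grid T N N.+1 by rewrite grid_last (le_trans it).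
by rewrite /grid ler_pM2r// ler_nat.
Qed.

Lemma grid_index_mono s t : s <= t -> (grid_index T N s <= grid_index T N t)%N.
Proof. by move=> st; apply: le_truncn; rewrite ler_pM2r ?invr_gt0. Qed.

Lemma grid_index0 : grid_index T N 0 = 0%N.
Proof. by apply: grid_index_eq; rewrite grid0 lexx add0r. Qed.

Lemma grid_index_last : grid_index T N T = N.+1.
Proof. by apply: grid_index_eq; rewrite grid_last lexx ltrDl. Qed.

End Grid.

Section Euler.
Variables (R : realType) (a T : R) (f : R -> R -> R) (m alpha : R -> R).
Hypotheses (a0 : 0 < a) (T0 : 0 < T) (cf : caratheodory_fun T f)
  (im : L1_fun T m) (fm : forall t x, 0 <= t <= T -> `|f t x| <= m t)
  (ial : L1_fun T alpha)
  (flip : {ae @completed_lebesgue_measure R, forall t : lebesgueR R,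
       t \in `[0, T] -> forall x y : R, `|f t x - f t y| <= alpha t * `|x - y|}).

Let m_ge0 t : 0 <= t <= T -> 0 <= m t.
Proof. by move=> tT; apply: le_trans (fm 0 tT). Qed.

Lemma field_L1 z : L1_fun T (f ^~ z).
Proof.
have mT : measurable (seg T) by exact: measurable_leb_itv.
apply: (le_integrable mT) im; first by apply/measurable_EFinP; exact: cf.1.
move=> t; rewrite /seg /= in_itv/= => tT; rewrite lee_fin.
by rewrite (le_trans (fm _ tT))// ler_norm.
Qed.

Lemma prim_field_le s t z : 0 <= s -> s <= t -> t <= T ->
  `|prim (f ^~ z) t - prim (f ^~ z) s| <= prim m t - prim m s.
Proof.
move=> s0 st tT; apply: (prim_le (field_L1 z) im) => //; apply: aeW => r /andP[sr rt].
by apply: fm; rewrite (le_trans s0)// (le_trans rt).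
Qed.

(** The dependence is Lipschitz, with constant the integral of the absolute
    value of [alpha]. *)
Lemma prim_field_continuous t : 0 <= t <= T -> continuous (fun z => prim (f ^~ z) t).
Proof.
move=> /andP[t0 tT] z; pose al s := `|alpha s|.
have iabs : L1_fun T al by exact: integrable_norm.
pose C := prim al t; have C0 : 0 <= C.
  by rewrite /C -(prim_at0 al); apply: (prim_ge0 iabs) => // r _; exact: normr_ge0.
have lip x : `|prim (f ^~ z) t - prim (f ^~ x) t| <= `|z - x| * C.
  have i1 : L1_fun T (fun s => -1 * f s x + f s z) by apply: L1_lin; exact: field_L1.
  have i2 : L1_fun T (fun s => `|z - x| * al s + cst 0 s) by exact: L1_lin (L1_cst0 T).
  have := @prim_le _ T 0 t _ _ i1 i2 (lexx 0) t0 tT.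
  rewrite !prim_at0 !(prim_lin (T := T)) ?t0//; try exact: field_L1; try exact: L1_cst0.
  rewrite prim_cst0 !subr0 addr0 mulN1r [- prim _ _ + _]addrC; apply.
  apply: filterS flip => s fl /andP[s0 st].
  rewrite mulN1r addrC addr0 mulrC; apply: le_trans (fl _ _ _) _.
    by rewrite in_itv/= s0 (le_trans st).
  by rewrite ler_wpM2r// ler_norm.
apply/cvgrPdist_le => e e0; apply/nbhs_ballP.
have C1 : 0 < C + 1 by rewrite ltr_wpDl.
exists (e / (C + 1)); first by rewrite /= divr_gt0.
move=> x; rewrite /ball/= ltr_pdivlMr// => xe; apply: le_trans (lip x) _.
by apply: le_trans (ltW xe); rewrite ler_wpM2l// lerDl.
Qed.

Variable N : nat.

Lemma euler_continuous i : (i <= N.+1)%N ->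
  continuous (fun lam => (euler a T f N lam i).1) /\
  continuous (fun lam => (euler a T f N lam i).2).
Proof.
elim: i => [_|i IH iN] /=; first by split=> lam; [exact: cvg_cst|exact: cvg_id].
have [cy cp] := IH (ltnW iN).
have E1 lam : (let: (y, p) := euler a T f N lam i in (y + T / N.+1%:R * p,
     p + slope a N y * (prim (f ^~ (fold a y)) (grid T N i.+1)
                        - prim (f ^~ (fold a y)) (grid T N i)))) =
   ((euler a T f N lam i).1 + T / N.+1%:R * (euler a T f N lam i).2,
    (euler a T f N lam i).2 + slope a N (euler a T f N lam i).1 *
      (prim (f ^~ (fold a (euler a T f N lam i).1)) (grid T N i.+1)
       - prim (f ^~ (fold a (euler a T f N lam i).1)) (grid T N i))).
  by case: euler.
split=> lam.
  rewrite (_ : (fun _ => _) = (fun lam => (euler a T f N lam i).1 + T / N.+1%:R * (euler a T f N lam i).2)).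
    by apply: cvgD; [exact: cy|apply: cvgMl_tmp; exact: cp].
  by apply/funext => l; rewrite E1.
rewrite (_ : (fun _ => _) = (fun lam => (euler a T f N lam i).2 + slope a N (euler a T f N lam i).1 *
      (prim (f ^~ (fold a (euler a T f N lam i).1)) (grid T N i.+1)
       - prim (f ^~ (fold a (euler a T f N lam i).1)) (grid T N i)))); last first.
  by apply/funext => l; rewrite E1.
have cpr j : (j <= N.+1)%N -> {for lam, continuous
    (fun lam => prim (f ^~ (fold a (euler a T f N lam i).1)) (grid T N j))}.
  move=> jN; apply: (@continuous_comp _ _ _ (fun lam => fold a (euler a T f N lam i).1)
    (fun z => prim (f ^~ z) (grid T N j))).
    by apply: continuous_comp; [exact: cy|exact: fold_continuous].
  by apply: prim_field_continuous; exact: grid_itv.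
apply: cvgD; first exact: cp; apply: cvgM.
  by apply: continuous_cvg; [exact: slope_continuous|exact: cy].
by apply: cvgB; apply: cpr => //; exact: ltnW.
Qed.

Variable lam : R.
Local Notation Y i := (euler a T f N lam i).1.
Local Notation P i := (euler a T f N lam i).2.

Lemma euler_positionS i : Y i.+1 = Y i + T / N.+1%:R * P i.
Proof. by rewrite /=; case: euler. Qed.

Lemma euler_velocityS i : P i.+1 = P i + slope a N (Y i) *
  (prim (f ^~ (fold a (Y i))) (grid T N i.+1) - prim (f ^~ (fold a (Y i))) (grid T N i)).
Proof. by rewrite /=; case: euler. Qed.

(** The velocities inherit the modulus of continuity of [prim m], whatever the
    step. *)
Lemma euler_velocity_le i j : (i <= j)%N -> (j <= N.+1)%N ->
  `|P j - P i| <= prim m (grid T N j) - prim m (grid T N i).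
Proof.
move=> ij; rewrite -(subnK ij); elim: (j - i)%N => [_|k IH kN].
  by rewrite add0n !subrr normr0.
rewrite addSn in kN *; have {}IH := IH (ltnW kN).
have st : `|P (k + i).+1 - P (k + i)| <=
    prim m (grid T N (k + i).+1) - prim m (grid T N (k + i)).
  rewrite euler_velocityS addrC addKr normrM.
  have /andP[g0 _] := grid_itv T0 (ltnW kN); have /andP[_ gT] := grid_itv T0 kN.
  apply: le_trans (prim_field_le (fold a (Y (k + i))) g0 (grid_le N T0 (leqnSn _)) gT).
  by rewrite ler_piMl// slope_le1.
have -> : P (k + i).+1 - P i = (P (k + i).+1 - P (k + i)) + (P (k + i) - P i) by ring.
by rewrite (le_trans (ler_normD _ _))//; lra.
Qed.

Lemma prim_m_le s t : 0 <= s -> s <= t -> t <= T -> prim m s <= prim m t.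
Proof. by move=> s0 st tT; exact: (prim_ge0 im). Qed.

Lemma euler_velocity_itv i : (i <= N.+1)%N ->
  lam - prim m T <= P i <= lam + prim m T.
Proof.
move=> iN; have := euler_velocity_le (leq0n i) iN.
rewrite grid0 prim_at0 subr0 -[P 0%N]/lam.
have /andP[g0 gT] := grid_itv T0 iN; have := prim_m_le g0 gT (lexx T).
by rewrite ler_norml => ? /andP[? ?]; apply/andP; split; lra.
Qed.

Lemma euler_position_le i j : (i <= j)%N -> (j <= N.+1)%N ->
  `|Y j - Y i - (grid T N j - grid T N i) * P i| <=
  (grid T N j - grid T N i) * (prim m (grid T N j) - prim m (grid T N i)).
Proof.
move=> ij; rewrite -(subnK ij); elim: (j - i)%N => [_|k IH kN].
  by rewrite add0n !subrr !mul0r subr0 normr0.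
rewrite addSn in kN *; have {}IH := IH (ltnW kN).
have st := euler_velocity_le (leq_addl k i) (ltnW kN).
rewrite euler_positionS gridS; set h := T / N.+1%:R.
have h0 : 0 < h by rewrite divr_gt0.
have -> : Y (k + i) + h * P (k + i) - Y i - (grid T N (k + i) + h - grid T N i) * P i =
  (Y (k + i) - Y i - (grid T N (k + i) - grid T N i) * P i) + h * (P (k + i) - P i) by ring.
rewrite (le_trans (ler_normD _ _))// normrM (gtr0_norm h0).
have /andP[g0 _] := grid_itv T0 (ltnW kN); have /andP[_ gT] := grid_itv T0 kN.
have Mle := prim_m_le g0 (grid_le N T0 (leqnSn _)) gT.
rewrite gridS -/h in Mle.
have gi : grid T N i <= grid T N (k + i) by apply: grid_le => //; exact: leq_addl.
have e1 : h * `|P (k + i) - P i| <= h * (prim m (grid T N (k + i) + h) - prim m (grid T N i)).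
  by rewrite ler_pM2l// (le_trans st)// lerD2r.
have e2 : (grid T N (k + i) - grid T N i) * (prim m (grid T N (k + i)) - prim m (grid T N i)) <=
    (grid T N (k + i) - grid T N i) * (prim m (grid T N (k + i) + h) - prim m (grid T N i)).
  by rewrite ler_wpM2l ?subr_ge0// lerD2r.
lra.
Qed.

Lemma euler_force_le t : 0 <= t <= T -> `|euler_force a T f N lam t| <= m t.
Proof.
move=> tT; rewrite /euler_force normrM; set y := fold a _; apply: le_trans (fm y tT).
by rewrite ler_piMl// slope_le1.
Qed.

Lemma measurable_euler_force :
  measurable_fun (seg T) (euler_force a T f N lam : lebesgueR R -> R).
Proof.
move=> _ B mB.
have mi i : measurable (`[grid T N i, grid T N i + T / N.+1%:R[%classic : set (lebesgueR R)).
  exact: measurable_leb_itv.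
pose g i t := slope a N (Y i) * f t (fold a (Y i)).
have mg i : measurable_fun (seg T) (g i : lebesgueR R -> R).
  by apply: measurable_funM; [exact: measurable_cst|exact: cf.1].
rewrite (_ : _ `&` _ = \bigcup_i ((`[grid T N i, grid T N i + T / N.+1%:R[%classic : set (lebesgueR R))
    `&` (seg T `&` g i @^-1` B))).
  apply: bigcupT_measurable => i; apply: measurableI; first exact: mi.
  by apply: mg => //; exact: measurable_leb_itv.
apply/seteqP; split=> t /=.
  rewrite /seg /= in_itv/= => -[/andP[t0 tT] Bt].
  exists (grid_index T N t) => //=; split; first by rewrite in_itv/= grid_index_itv.
  by split=> //; rewrite in_itv/= t0.
move=> [i _ [/=]]; rewrite in_itv/= => it [tT Bt]; split=> //.
by rewrite /euler_force (grid_index_eq T0 it).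
Qed.

Lemma euler_force_L1 : L1_fun T (euler_force a T f N lam).
Proof.
have mT : measurable (seg T) by exact: measurable_leb_itv.
apply: (le_integrable mT) im; first by apply/measurable_EFinP; exact: measurable_euler_force.
move=> t; rewrite /seg /= in_itv/= => tT; rewrite lee_fin.
by rewrite (le_trans (euler_force_le tT))// ler_norm.
Qed.

Lemma euler_velocityE i : (i <= N.+1)%N ->
  P i = lam + prim (euler_force a T f N lam) (grid T N i).
Proof.
elim: i => [_|i IH iN]; first by rewrite grid0 prim_at0 addr0.
rewrite euler_velocityS IH; last exact: ltnW.
have /andP[g0 _] := grid_itv T0 (ltnW iN); have /andP[_ gT] := grid_itv T0 iN.
have gi : grid T N i <= grid T N i.+1 by exact: grid_le.
have iz := field_L1 (fold a (Y i)).
have ig : L1_fun T (fun t => slope a N (Y i) * f t (fold a (Y i)) + cst 0 t).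
  exact: L1_lin (L1_cst0 T).
have : prim (euler_force a T f N lam) (grid T N i.+1) - prim (euler_force a T f N lam) (grid T N i) =
   prim (fun t => slope a N (Y i) * f t (fold a (Y i)) + cst 0 t) (grid T N i.+1) -
   prim (fun t => slope a N (Y i) * f t (fold a (Y i)) + cst 0 t) (grid T N i).
  apply: (prim_eq euler_force_L1 ig) => //.
  apply: filterS (ae_neq (grid T N i.+1)) => r nr /andP[ir ri].
  rewrite addr0 /euler_force (@grid_index_eq _ _ _ T0 i)// ir -gridS.
  by rewrite lt_neqAle nr.
rewrite !(prim_lin (T := T)) ?g0 ?gT ?(le_trans g0) ?(le_trans gi)//; try exact: L1_cst0.
rewrite !prim_cst0 !addr0 => E.
rewrite -addrA; congr (_ + _); rewrite mulrBr -E; ring.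
Qed.

End Euler.

(** * Limits of Euler approximations *)

(** A cluster point exists by compactness, and an ultrafilter converges to each
    of its cluster points. *)
Lemma ultra_bounded_cvg (R : realType) (U : set_system nat) (B : R) (u : nat -> R) :
  UltraFilter U -> (forall n, `|u n| <= B) -> exists l : R, u n @[n --> U] --> l.
Proof.
move=> UF uB; have PF : ProperFilter U by exact: ultra_proper.
have PU : ProperFilter (u n @[n --> U]) by exact: fmap_proper_filter.
have [|l [_ cl]] := @segment_compact R (- B) B (u n @[n --> U]) PU.
  apply: (@filterS _ U _ setT); last exact: filterT.
  by move=> n _; rewrite /= in_itv/= -ler_norml.
exists l; apply/cvgrPdist_lt => e e0.
have [//|nU] := in_ultra_setVsetC [set n | `|l - u n| < e] UF.
have [|x []] := cl (~` [set x | `|l - x| < e]) (ball l e) _ (nbhsx_ballx _ _ e0).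
  exact: nU.
by rewrite /ball/=.
Qed.

Lemma cvg_inv_bound (R : realType) (u : nat -> R) (l C : R) :
  (forall k, `|u k - l| <= C * k.+1%:R^-1) -> u k @[k --> \oo] --> l.
Proof.
move=> uC; apply/cvgrPdist_le => e e0.
have : C * harmonic k @[k --> \oo] --> C * 0 by apply: cvgMl_tmp; exact: cvg_harmonic.
rewrite mulr0 => /cvgrPdist_le/(_ e e0); apply: filterS => k.
rewrite sub0r normrN distrC => H; apply: le_trans (uC k) _.
exact: le_trans (ler_norm _) H.
Qed.

Section EulerLimit.
Variables (R : realType) (a T : R) (f : R -> R -> R) (m : R -> R).
Hypotheses (a0 : 0 < a) (T0 : 0 < T) (cf : caratheodory_fun T f)
  (im : L1_fun T m) (fm : forall t x, 0 <= t <= T -> `|f t x| <= m t).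
Variables (lo hi : R) (lam : nat -> R) (U : set_system nat).
Hypotheses (lo_gt : prim m T < lo) (lam_itv : forall N, lo <= lam N <= hi)
  (UF : UltraFilter U) (Uoo : forall k, U [set N | (k <= N)%N]).

Let PF : ProperFilter U.
Proof. exact: ultra_proper. Qed.

Let M := prim m.
Let g N t := grid T N (grid_index T N t).
Let Y N t := (euler a T f N (lam N) (grid_index T N t)).1.
Let P N t := (euler a T f N (lam N) (grid_index T N t)).2.
Let B := hi + M T.

Let M_mono s t : 0 <= s -> s <= t -> t <= T -> M s <= M t.
Proof. exact: (prim_m_le im fm). Qed.

Let M_ge0 t : 0 <= t <= T -> 0 <= M t.
Proof. by move=> /andP[t0 tT]; rewrite /M -(prim_at0 m); exact: M_mono. Qed.

Let inT0 : 0 <= T <= T. Proof. by rewrite lexx ltW. Qed.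
Let in00 : 0 <= (0 : R) <= T. Proof. by rewrite lexx ltW. Qed.

Let g_le N t : 0 <= t <= T -> 0 <= g N t <= t.
Proof.
move=> tT; have /andP[g0 _] := grid_itv T0 (grid_index_le N T0 tT).
by have /andP[t0 _] := tT; have /andP[] := grid_index_itv N T0 t0; rewrite /g g0 => ->.
Qed.

Let g_close N t : 0 <= t <= T -> t - g N t <= T * N.+1%:R^-1.
Proof.
move=> /andP[t0 tT]; have /andP[_] := grid_index_itv N T0 t0.
by rewrite -/(g N t) => H; rewrite lerBlDl ltW.
Qed.

Let g_mono N s t : s <= t -> g N s <= g N t.
Proof. by move=> st; apply: grid_le => //; exact: grid_index_mono. Qed.

Let velocity_diff N s t : 0 <= s -> s <= t -> t <= T ->
  `|P N t - P N s| <= M (g N t) - M (g N s).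
Proof.
move=> s0 st tT; apply: euler_velocity_le => //; first exact: grid_index_mono.
by apply: grid_index_le => //; rewrite (le_trans s0).
Qed.

Let position_diff N s t : 0 <= s -> s <= t -> t <= T ->
  `|Y N t - Y N s - (g N t - g N s) * P N s| <= (g N t - g N s) * (M (g N t) - M (g N s)).
Proof.
move=> s0 st tT; apply: euler_position_le => //; first exact: grid_index_mono.
by apply: grid_index_le => //; rewrite (le_trans s0).
Qed.

Let velocity_itv N t : 0 <= t <= T -> lo - M T <= P N t <= B.
Proof.
move=> tT; have /andP[] := euler_velocity_itv a0 T0 cf im fm (lam N) (grid_index_le N T0 tT).
rewrite -/(P N t) -/M /B; have /andP[? ?] := lam_itv N.
by move=> ? ?; apply/andP; split; lra.
Qed.

Let B_ge0 : 0 <= B.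
Proof.
have := velocity_itv 0 in00; have := M_ge0 inT0; have := lo_gt; rewrite -/M /B.
by have /andP[? ?] := lam_itv 0 => ? ? /andP[? ?]; lra.
Qed.

Let M_le_B : M T <= B.
Proof.
have := M_ge0 inT0; have := lo_gt; rewrite -/M /B.
by have /andP[? ?] := lam_itv 0 => ? ?; lra.
Qed.

Let position_lip N s t : 0 <= s -> s <= t -> t <= T ->
  `|Y N t - Y N s| <= (g N t - g N s) * (2 * B).
Proof.
move=> s0 st tT; have := position_diff N s0 st tT.
have tT' : 0 <= t <= T by rewrite (le_trans s0).
have sT : 0 <= s <= T by rewrite s0 (le_trans st).
have gst : 0 <= g N t - g N s by rewrite subr_ge0 g_mono.
have /andP[gs0 gs] := g_le N sT; have /andP[gt0 gt] := g_le N tT'.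
have gsT : 0 <= g N s <= T by rewrite gs0 (le_trans gs)//; case/andP: sT.
have /andP[p1 p2] := velocity_itv N sT.
have pB : `|P N s| <= B.
  rewrite ger0_norm//; apply: le_trans p1; rewrite subr_ge0; exact: ltW.
have MB : M (g N t) - M (g N s) <= B.
  have := M_ge0 gsT; have : M (g N t) <= M T by apply: M_mono; rewrite ?(le_trans gt).
  by have := M_le_B; lra.
have e1 := ler_wpM2l gst MB; have e2 := ler_wpM2l gst pB.
have : `|Y N t - Y N s| <= `|Y N t - Y N s - (g N t - g N s) * P N s| + `|(g N t - g N s) * P N s|.
  by rewrite -[X in `|X| <= _](subrK ((g N t - g N s) * P N s)) ler_normD.
by rewrite [`|(_ - _) * _|]normrM (ger0_norm gst); lra.
Qed.

Let Y0 N : Y N 0 = 0.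
Proof. by rewrite /Y grid_index0. Qed.

Let P0 N : P N 0 = lam N.
Proof. by rewrite /P grid_index0. Qed.

Let cvg_along (u : nat -> R) (l e : R) : u N @[N --> U] --> l -> 0 < e ->
  U [set N | `|u N - l| <= e].
Proof.
move=> /cvgrPdist_le H e0; apply: (@filterS _ U _ _ _ _ (H e e0)) => N.
by rewrite /= distrC.
Qed.

Let g_cvg t : 0 <= t <= T -> g N t @[N --> U] --> t.
Proof.
move=> tT; apply/cvgrPdist_le => e e0.
have /cvgrPdist_le/(_ e e0)[K _ HK] : T * harmonic k @[k --> \oo] --> T * 0.
  by apply: cvgMl_tmp; exact: cvg_harmonic.
apply: filterS (Uoo K) => N KN /=.
have /andP[_ gt] := g_le N tT; rewrite ger0_norm ?subr_ge0//.
apply: le_trans (g_close N tT) _; have := HK N KN.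
by rewrite /= mulr0 sub0r normrN; apply: le_trans; exact: ler_norm.
Qed.

Let M_continuous : {within `[0, T], continuous M}.
Proof. by apply: abs_cont_continuous; apply: prim_ac => //; exact: ltW. Qed.

Let Mg_cvg t : 0 <= t <= T -> M (g N t) @[N --> U] --> M t.
Proof.
move=> tT; apply/cvgrPdist_le => e e0.
have [|d d0 Hd] := (within_continuousP _ _).1 M_continuous t _ e e0.
  by rewrite /= in_itv.
have d20 : 0 < d / 2 by rewrite divr_gt0.
apply: filterS (cvg_along (g_cvg tT) d20) => N /= gd.
rewrite distrC; apply: Hd; last by apply: le_lt_trans gd _; lra.
have /andP[g0 gt] := g_le N tT; rewrite /= in_itv/= g0 (le_trans gt)//.
by case/andP: tT.
Qed.

(** Along the ultrafilter the bounded approximations converge; the velocities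
    share the modulus of continuity of [prim m], which makes the limits a motion
    and its velocity. Its force is identified by dominated convergence along a
    sequence extracted from the ultrafilter, on which the positions converge
    uniformly. *)
Lemma euler_limit : exists (v : R) (y p : R -> R), [/\ lam N @[N --> U] --> v,
  (euler a T f N (lam N) N.+1).1 @[N --> U] --> y T &
  unfolded_solution a T f v y p].
Proof.
have [|v lamv] := @ultra_bounded_cvg R U B lam UF.
  move=> N.
  have /andP[? ?] := lam_itv N; have := M_ge0 inT0; have := lo_gt; rewrite -/M => ? ?.
  by rewrite ger0_norm /B; lra.
have [y yP] : exists y : R -> R, forall t, 0 <= t <= T -> Y N t @[N --> U] --> y t.
  suff /choice[y yP] : forall t : R, exists l : R, 0 <= t <= T -> Y N t @[N --> U] --> l by exists y.
  move=> t; have [tT|nT] := pselect (0 <= t <= T); last by exists 0.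
  have [|l Hl] := @ultra_bounded_cvg _ U (T * (2 * B)) (Y ^~ t) UF; last by exists l.
  move=> N; have /andP[t0 tT'] := tT; have := position_lip N (lexx 0) t0 tT'.
  rewrite Y0 subr0 => /le_trans; apply; apply: ler_wpM2r; first by rewrite mulr_ge0.
  have /andP[_ gt] := g_le N tT; have /andP[g0 _] := g_le N in00.
  lra.
have [p pP] : exists p : R -> R, forall t, 0 <= t <= T -> P N t @[N --> U] --> p t.
  suff /choice[p pP] : forall t : R, exists l : R, 0 <= t <= T -> P N t @[N --> U] --> l by exists p.
  move=> t; have [tT|nT] := pselect (0 <= t <= T); last by exists 0.
  have [|l Hl] := @ultra_bounded_cvg _ U B (P ^~ t) UF; last by exists l.
  move=> N; have /andP[p1 p2] := velocity_itv N tT.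
  by rewrite ger0_norm//; apply: le_trans p1; rewrite subr_ge0; exact: ltW.
have p_itv t : 0 <= t <= T -> 0 < p t <= B.
  move=> tT; apply/andP; split.
    apply: (@lt_le_trans _ _ (lo - M T)); first by rewrite subr_gt0.
    apply: (ler_cvg_to (cvg_cst _) (pP t tT)); apply: nearW => N.
    by have /andP[] := velocity_itv N tT.
  apply: (ler_cvg_to (pP t tT) (cvg_cst _)); apply: nearW => N.
  by have /andP[] := velocity_itv N tT.
have p_diff s t : 0 <= s -> s <= t -> t <= T -> `|p t - p s| <= M t - M s.
  move=> s0 st tT; have tT' : 0 <= t <= T by rewrite (le_trans s0).
  have sT : 0 <= s <= T by rewrite s0 (le_trans st).
  apply: (ler_cvg_to (cvg_norm (cvgB (pP t tT') (pP s sT))) (cvgB (Mg_cvg tT') (Mg_cvg sT))).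
  by apply: nearW => N; exact: velocity_diff.
have y_diff s t : 0 <= s -> s <= t -> t <= T ->
    `|y t - y s - (t - s) * p s| <= (t - s) * (M t - M s).
  move=> s0 st tT; have tT' : 0 <= t <= T by rewrite (le_trans s0).
  have sT : 0 <= s <= T by rewrite s0 (le_trans st).
  have gts : g N t - g N s @[N --> U] --> t - s by apply: cvgB; exact: g_cvg.
  have lhs : `|Y N t - Y N s - (g N t - g N s) * P N s| @[N --> U] -->
      `|y t - y s - (t - s) * p s|.
    apply: cvg_norm; apply: cvgB; first by apply: cvgB; exact: yP.
    by apply: cvgM => //; exact: pP.
  have rhs : (g N t - g N s) * (M (g N t) - M (g N s)) @[N --> U] --> (t - s) * (M t - M s).
    by apply: cvgM => //; apply: cvgB; exact: Mg_cvg.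
  by apply: (ler_cvg_to lhs rhs); apply: nearW => N; exact: position_diff.
have y_lip s t : 0 <= s -> s <= t -> t <= T -> `|y t - y s| <= (t - s) * (2 * B).
  move=> s0 st tT; have tT' : 0 <= t <= T by rewrite (le_trans s0).
  have sT : 0 <= s <= T by rewrite s0 (le_trans st).
  have gts : g N t - g N s @[N --> U] --> t - s by apply: cvgB; exact: g_cvg.
  apply: (ler_cvg_to (cvg_norm (cvgB (yP t tT') (yP s sT))) (cvgMr_tmp gts)).
  by apply: nearW => N; exact: position_lip.
have y00 : y 0 = 0.
  have := yP 0 in00; rewrite (_ : (fun N => Y N 0) = fun=> 0); last by apply/funext => N; rewrite Y0.
  by move=> /cvg_lim <-//; rewrite lim_cst.
have p0v : p 0 = v.
  have := pP 0 in00; rewrite (_ : (fun N => P N 0) = lam); last by apply/funext => N; rewrite P0.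
  by move=> /cvg_lim <-//; exact: cvg_lim.
have dy t : 0 <= t <= T -> 0 < p t /\ has_deriv_within `[0, T] y t (p t).
  move=> tT; split; first by have /andP[] := p_itv t tT.
  apply/has_deriv_withinP => e e0.
  have e20 : 0 < e / 2 by rewrite divr_gt0.
  have [|d d0 Hd] := (within_continuousP _ _).1 M_continuous t _ _ e20.
    by rewrite /= in_itv.
  exists d => // s sT sd; have := Hd s sT sd; move: sT; rewrite /= in_itv/= => sT {}Hd.
  have /andP[s0 s_T] := sT; have /andP[t0 t_T] := tT.
  have [st|/ltW ts] := leP s t.
    have := y_diff s t s0 st t_T; have := p_diff s t s0 st t_T.
    have ts0 : 0 <= t - s by rewrite subr_ge0.
    have {}Hd : M t - M s <= e / 2 by apply: le_trans Hd; rewrite distrC ler_norm.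
    move=> h1 h2; rewrite [`|s - t|]distrC (ger0_norm ts0).
    have -> : y s - y t - p t * (s - t) =
      - (y t - y s - (t - s) * p s) + (t - s) * (p t - p s) by ring.
    rewrite (le_trans (ler_normD _ _))// normrN normrM (ger0_norm ts0).
    have := ler_wpM2l ts0 (le_trans h1 Hd); have := ler_wpM2l ts0 Hd.
    lra.
  have := y_diff t s t0 ts s_T.
  have ts0 : 0 <= s - t by rewrite subr_ge0.
  have {}Hd : M s - M t <= e / 2 by apply: le_trans Hd; rewrite ler_norm.
  rewrite (ger0_norm ts0) [p t * _]mulrC => /le_trans; apply.
  have := ler_wpM2l ts0 Hd; have := mulr_ge0 ts0 (ltW e0).
  lra.
have [cy incy] := has_deriv_pos_increasing dy.
have y_ge0 t : 0 <= t <= T -> 0 <= y t.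
  move=> /andP[]; rewrite le_eqVlt => /predU1P[<-|t0] tT; first by rewrite y00.
  by rewrite -y00 ltW// incy.
pose F s := (-1) ^+ branch a (y s) * f s (fold a (y s)).
have off_walls : {ae leb, forall s : lebesgueR R, forall n : nat, 0 <= s <= T ->
    y s != 2 * a * n%:R + a}.
  apply: ae_foralln => n.
  have [[s0 [s0T ys0]]|no] := pselect (exists s0, 0 <= s0 <= T /\ y s0 = 2 * a * n%:R + a).
    apply: filterS (ae_neq s0) => s ns /andP[s_0 sT]; rewrite -ys0.
    have /andP[s00 s0_T] := s0T.
    by have [lt|lt|eq] := ltgtP s s0; [rewrite lt_eqF// incy|rewrite gt_eqF// incy|rewrite eq eqxx in ns].
  by apply: aeW => s sT; apply/negP => /eqP ys; apply: no; exists s.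
have key t : 0 <= t <= T -> L1_fun T F /\ p t = v + prim F t.
  move=> tT.
  (* the sequence depends on [t], since it is also to make the velocities at [t]
     converge *)
  pose good k := [set N | (k <= N)%N /\ (forall j : 'I_k.+2,
     `|Y N (grid T k j) - y (grid T k j)| <= k.+1%:R^-1) /\
     `|P N t - p t| <= k.+1%:R^-1 /\ `|lam N - v| <= k.+1%:R^-1].
  have Ugood k : U (good k).
    have k0 : 0 < k.+1%:R^-1 :> R by rewrite invr_gt0.
    apply: filterI; first exact: Uoo.
    apply: filterI.
      apply: filter_forall => j; apply: cvg_along => //.
      by apply: yP; apply: grid_itv => //; rewrite -ltnS.
    by apply: filterI; apply: cvg_along => //; exact: pP.
  have /choice[N_ HN] : forall k, exists N, good k N by move=> k; exact: filter_ex (Ugood k).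
  have Nk k : (N_ k).+1%:R^-1 <= k.+1%:R^-1 :> R.
    by rewrite lef_pV2 ?posrE// ler_nat ltnS; case: (HN k).
  have Ycvg s : 0 <= s <= T -> Y (N_ k) s @[k --> \oo] --> y s.
    move=> sT; apply: (@cvg_inv_bound _ _ _ (T * (6 * B) + 1)) => k.
    have [kN [Hj _]] := HN k; have /andP[s0 s_T] := sT.
    have jk : (grid_index T k s < k.+2)%N by rewrite ltnS; exact: grid_index_le.
    have := Hj (Ordinal jk); rewrite /=; set r := grid T k _ => Hr.
    have /andP[r0 rT] : 0 <= r <= T by apply: grid_itv.
    have /andP[rs sr] := grid_index_itv k T0 s0; rewrite -/r in rs sr.
    have h1 := position_lip (N_ k) r0 rs s_T; have h2 := y_lip r s r0 rs s_T.
    have gap : g (N_ k) s - g (N_ k) r <= 2 * (T * k.+1%:R^-1).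
      have /andP[_ gs] := g_le (N_ k) sT.
      have rT' : 0 <= r <= T by rewrite r0.
      have gr := g_close (N_ k) rT'; have := ler_wpM2l (ltW T0) (Nk k).
      move: gs gr sr rs; set x1 := T / (N_ k).+1%:R; set x2 := T / k.+1%:R.
      move: (g _ s) (g _ r) x1 x2 => ? ? ? ? ? ? ? ? ?.
      lra.
    have h3 := ler_wpM2r (mulr_ge0 (ler0n _ 2) B_ge0) gap.
    have gap2 : s - r <= T * k.+1%:R^-1 by rewrite lerBlDl ltW.
    have h4 := ler_wpM2r (mulr_ge0 (ler0n _ 2) B_ge0) gap2.
    have -> : Y (N_ k) s - y s = (Y (N_ k) s - Y (N_ k) r) + ((Y (N_ k) r - y r) - (y s - y r)) by ring.
    rewrite (le_trans (ler_normD _ _))//.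
    have := ler_normB (Y (N_ k) r - y r) (y s - y r).
    move: h1 h2 h3 h4 Hr; set z1 := `|_|; set z2 := `|_|; set z3 := `|_|; set z4 := `|_|.
    move: (_ * (2 * B)) ((s - r) * _) => ? ?.
    by move: (k.+1%:R^-1) z1 z2 z3 z4 B => ? ? ? ? ? ? *; lra.
  pose h k := euler_force a T f (N_ k) (lam (N_ k)).
  have hF (s : R) : 0 <= s <= T -> continuous (f s) ->
      (forall n : nat, y s != 2 * a * n%:R + a) -> h ^~ s @ \oo --> F s.
    move=> sT fs ow.
    have ays : - a <= y s by apply: le_trans (y_ge0 s sT); rewrite oppr_le0 ltW.
    set n := branch a (y s); have yu := branch_lt (y s) a0; rewrite -/n in yu.
    have yl : 2 * a * n%:R - a < y s.
      have := branch_le a0 ays; rewrite -/n le_eqVlt => /predU1P[E|//].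
      case: (n) E => [|n'] E; first by have := y_ge0 s sT; rewrite -E mulr0; have := a0; lra.
      by have := ow n'; rewrite -E -natr1 => /eqP[]; ring.
    have Zs := Ycvg s sT.
    (* the two points of the difference quotient are eventually in one strip,
       where [fold a] is affine *)
    have slopeE : \forall k \near \oo, slope a (N_ k) (Y (N_ k) s) = (-1) ^+ n.
      pose d := Num.min (y s - (2 * a * n%:R - a)) (2 * a * n%:R + a - y s).
      have d0 : 0 < d / 2 by rewrite divr_gt0// lt_min !subr_gt0 yl.
      have dl : d <= y s - (2 * a * n%:R - a) by rewrite ge_min lexx.
      have dr : d <= 2 * a * n%:R + a - y s by rewrite ge_min lexx orbT.
      have [K1 _ n1] := (cvgrPdist_le _ _).1 Zs _ d0.
      have [K2 _ n2] := (cvgrPdist_le _ _).1 (@cvg_harmonic R) _ d0.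
      exists (maxn K1 K2); first exact: I.
      move=> k /= K12; have /n1 + : (K1 <= k)%N by apply: leq_trans K12; exact: leq_maxl.
      have /n2 + : (K2 <= k)%N by apply: leq_trans K12; exact: leq_maxr.
      rewrite /= sub0r normrN => hk; rewrite ler_norml => /andP[z1 z2].
      have {}hk : (N_ k).+1%:R^-1 <= d / 2.
        by rewrite (le_trans (Nk k))// (le_trans _ hk)// ler_norm.
      have i0 : 0 < (N_ k).+1%:R^-1 :> R by rewrite invr_gt0.
      rewrite /slope; move: (Y (N_ k) s) ((N_ k).+1%:R^-1) (mulVf (lt0r_neq0 (ltr0Sn R (N_ k)))) z1 z2 hk i0 => z i iN z1 z2 hk i0.
      clearbody d.
      rewrite (@fold_on _ _ (z + i) n)//; last by apply/andP; split; lra.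
      rewrite (@fold_on _ _ z n)//; last by apply/andP; split; lra.
      rewrite -mulrBr (_ : _ - _ - _ = i); last by ring.
      by rewrite -mulrA iN mulr1.
    have cont : (-1) ^+ n * f s (fold a (Y (N_ k) s)) @[k --> \oo] --> F s.
      apply: cvgMl_tmp; apply: continuous_cvg; first exact: fs.
      by apply: continuous_cvg => //; exact: fold_continuous.
    apply: cvg_trans cont; apply: near_eq_cvg.
    by apply: filterS slopeE => k E; rewrite /h /euler_force -/(Y (N_ k) s) E.
  have {}hF : {ae leb, forall s : lebesgueR R, s \in `[0, T] -> h ^~ s @ \oo --> F s}.
    have fae := ae_filter_ringOfSetsType (@completed_lebesgue_measure R).
    apply: (@filterS2 _ _ fae _ _ _ _ cf.2 off_walls) => s fs ow sT.
    have {}fs := fs sT; move: sT; rewrite in_itv/= => sT.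
    by apply: hF => // n; exact: ow.
  have [iF cF] := prim_dct im (fun k => measurable_euler_force a T0 cf (N_ k) (lam (N_ k)))
    (fun k r rT => euler_force_le a0 fm (N_ k) (lam (N_ k)) rT) hF.
  split=> //.
  have Pcvg : P (N_ k) t @[k --> \oo] --> p t.
    by apply: (@cvg_inv_bound _ _ _ 1) => k; rewrite mul1r; have [_ [_ []]] := HN k.
  have Lcvg : lam (N_ k) @[k --> \oo] --> v.
    by apply: (@cvg_inv_bound _ _ _ 1) => k; rewrite mul1r; have [_ [_ []]] := HN k.
  have gcvg : g (N_ k) t @[k --> \oo] --> t.
    apply: (@cvg_inv_bound _ _ _ T) => k; have /andP[_ gt] := g_le (N_ k) tT.
    rewrite distrC ger0_norm ?subr_ge0//; apply: le_trans (g_close _ tT) _.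
    by rewrite ler_wpM2l// ltW.
  have Mcvg : M (g (N_ k) t) @[k --> \oo] --> M t.
    apply/cvgrPdist_le => e e0.
    have [|d d0 Hd] := (within_continuousP _ _).1 M_continuous t _ e e0.
      by rewrite /= in_itv.
    have d20 : 0 < d / 2 by rewrite divr_gt0.
    apply: filterS ((cvgrPdist_le _ _).1 gcvg _ d20) => k gd /=.
    rewrite distrC; apply: Hd; last by rewrite distrC; apply: le_lt_trans gd _; lra.
    have /andP[g0 gt] := g_le (N_ k) tT; rewrite /= in_itv/= g0 (le_trans gt)//.
    by case/andP: tT.
  have lim0 : `|P (N_ k) t - lam (N_ k) - prim (h k) t| @[k --> \oo] --> `|p t - v - prim F t|.
    by apply: cvg_norm; apply: cvgB; [apply: cvgB|exact: cF].
  have limM : M t - M (g (N_ k) t) @[k --> \oo] --> 0.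
    by rewrite -(subrr (M t)); apply: cvgB => //; exact: cvg_cst.
  have : `|p t - v - prim F t| <= 0.
    apply: (ler_cvg_to lim0 limM); apply: nearW => k.
    have /andP[g0 gt] := g_le (N_ k) tT; have /andP[_ t_T] := tT.
    rewrite -/(h k) (_ : P (N_ k) t = lam (N_ k) + prim (h k) (g (N_ k) t)); last first.
      by apply: (euler_velocityE a0 T0 cf im fm); exact: grid_index_le.
    rewrite (_ : _ - _ - _ = - (prim (h k) t - prim (h k) (g (N_ k) t))); last by ring.
    rewrite normrN; apply: (prim_le _ im g0 gt t_T).
      exact: (euler_force_L1 a0 T0 cf im fm).
    apply: aeW => r /andP[gr rt]; apply: euler_force_le => //.
    by rewrite (le_trans g0)// (le_trans rt).
  by rewrite normr_le0 subr_eq0 => /eqP <-; ring.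
have [iF _] := key 0 in00.
exists v, y, p; split=> //.
  have := yP T inT0; rewrite (_ : (fun N => Y N T) = fun N => (euler a T f N (lam N) N.+1).1)//.
  by apply/funext => N; rewrite /Y grid_index_last.
split=> //.
- apply: (@abs_cont_eq _ _ (fun t => 1 * prim F t + cst v t)).
    by move=> t; rewrite /= in_itv/= mul1r addrC => tT; have [_ ->] := key t tT.
  apply: abs_cont_lin; first by apply: prim_ac => //; exact: ltW.
  by move=> e e0; exists 1 => // n u w _ _ _; rewrite big1// => i _; rewrite subrr normr0.
- apply: filterS (prim_deriv iF) => t H tT.
  have := @has_deriv_within_lin _ _ _ (cst v) 1 _ _ 0 (H tT) (@has_deriv_within_cst _ _ _ _).
  rewrite mul1r addr0; apply: has_deriv_within_eq.
    exists 1 => // s; rewrite /= in_itv/= => sT _.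
    by rewrite mul1r addrC; have [_ ->] := key s sT.
  by move: tT; rewrite in_itv/= => tT; rewrite mul1r addrC; have [_ ->] := key t tT.
Qed.

End EulerLimit.

(** * Solutions of the Dirichlet problem *)

(** By uniqueness, the limit of the Euler approximations with initial velocity
    [v] is the unfolding of any given solution with that velocity. *)
Lemma euler_limit_cauchy (R : realType) (a T v : R) (f : R -> R -> R)
    (m alpha x : R -> R) (U : set_system nat) :
  0 < a -> 0 < T -> caratheodory_fun T f -> L1_fun T m ->
  (forall t x : R, 0 <= t <= T -> `|f t x| <= m t) -> L1_fun T alpha ->
  {ae @completed_lebesgue_measure R, forall t : lebesgueR R, t \in `[0, T] ->
     forall x y : R, `|f t x - f t y| <= alpha t * `|x - y|} ->
  prim m T < v -> cauchy_solution a T f v x ->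
  UltraFilter U -> (forall k, U [set N | (k <= N)%N]) ->
  exists y p : R -> R, [/\ (euler a T f N v N.+1).1 @[N --> U] --> y T,
    unfolded_solution a T f v y p &
    impact_times a T (fold a \o y) = impact_times a T x].
Proof.
move=> a0 T0 cf im fm ial flip mv xsol UF Uoo.
have vv (N : nat) : v <= v <= v by rewrite lexx.
have [v' [y [p [cv cy uy]]]] := euler_limit a0 T0 cf im fm mv vv UF Uoo.
have PF : ProperFilter U by exact: ultra_proper.
have v'E : v' = v by rewrite -(cvg_lim (@Rhausdorff R) cv) lim_cst.
rewrite v'E in uy; exists y, p; split=> //.
have [ysol nz] := fold_unfolded a0 T0 uy.
have E := cauchy_unique a0 (ltW T0) ial flip ysol xsol nz.
by apply/seteqP; split=> s [sT xs]; split=> //; [rewrite -(E s sT)|rewrite (E s sT)].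
Qed.

Lemma prim_L1_norm (R : realType) (T : R) (m : R -> R) :
  L1_fun T m -> (forall t, 0 <= t <= T -> 0 <= m t) ->
  (prim m T)%:E = L1_norm T m.
Proof.
move=> im m0; have mT : measurable (seg T) by exact: measurable_leb_itv.
rewrite /prim /Rintegral fineK; last exact: (integrable_fin_num mT im).
apply: eq_integral => t; rewrite inE /seg /= in_itv/= => tT.
by rewrite ger0_norm// m0.
Qed.

Theorem theorem3p2 (R : realType) (a T : R) (f : R -> R -> R)
    (m alpha : R -> R) (v w : R) (xv xw : R -> R) (k j : nat)
    (ts : k.-tuple R) (ss : (k + j).-tuple R)
    (a_gt0 : 0 < a) (T_gt0 : 0 < T)
    (f_cara : caratheodory_fun T f)
    (m_L1 : L1_fun T m)
    (f_le_m : forall t x : R, 0 <= t <= T -> `|f t x| <= m t)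
    (alpha_L1 : L1_fun T alpha)
    (f_lip : {ae @completed_lebesgue_measure R, forall t : lebesgueR R,
       t \in `[0, T] ->
       forall x y : R, `|f t x - f t y| <= alpha t * `|x - y|})
    (v_gt : (L1_norm T m < v%:E)%E) (w_gt : (L1_norm T m < w%:E)%E)
    (xv_sol : cauchy_solution a T f v xv)
    (xw_sol : cauchy_solution a T f w xw)
    (ts_sorted : sorted <%R ts)
    (ts_impacts : impact_times a T xv = [set s | s \in ts])
    (ss_sorted : sorted <%R ss)
    (ss_impacts : impact_times a T xw = [set s | s \in ss])
    (j_ge2 : (2 <= j)%N) :
  exists x : R -> R, dirichlet_solution a T f x.
Proof.
have m_ge0 t : 0 <= t <= T -> 0 <= m t by move=> tT; apply: le_trans (f_le_m t 0 tT).
have mv : prim m T < v by rewrite -lte_fin prim_L1_norm.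
have mw : prim m T < w by rewrite -lte_fin prim_L1_norm.
have [U [UF subU]] := @ultraFilterLemma nat \oo _.
have PF : ProperFilter U by exact: ultra_proper.
have Uoo n : U [set N | (n <= N)%N] by apply: subU; exact: nbhs_infty_ge.
have [yv [pv [cyv uyv impv]]] :=
  euler_limit_cauchy a_gt0 T_gt0 f_cara m_L1 f_le_m alpha_L1 f_lip mv xv_sol UF Uoo.
have [yw [pw [cyw uyw impw]]] :=
  euler_limit_cauchy a_gt0 T_gt0 f_cara m_L1 f_le_m alpha_L1 f_lip mw xw_sol UF Uoo.
(* a preimage of 0 under folding which lies between the two final positions *)
pose c := 2 * a * k.+1%:R.
have yv_lt : yv T < c.
  have := @unfolded_impacts_lt _ _ _ _ _ _ _ ts a_gt0 T_gt0 uyv.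
  rewrite impv ts_impacts size_tuple /c -natr1 => /(_ (fun=> id)) H.
  lra.
have yw_gt : c < yw T.
  have := @unfolded_impacts_ge _ _ _ _ _ _ _ ss k.+1 a_gt0 uyw.
  rewrite impw ss_impacts size_tuple -/c => /(_ _ (fun=> id)) H.
  have {}H : c + a <= yw T.
    apply: H; first exact: (sorted_uniq lt_trans ltxx ss_sorted).
    by rewrite -(addn2 k) leq_add2l.
  lra.
pose Y N lam := (euler a T f N lam N.+1).1.
have Uv : U [set N | Y N v < c] by exact: (cvgr_lt _ cyv).
have Uw : U [set N | c < Y N w] by exact: (cvgr_gt _ cyw).
pose lo := Num.min v w; pose hi := Num.max v w.
have lohi : lo <= hi by rewrite ge_min le_max lexx.
have /choice[lam lamP] : forall N, exists l : R,
    lo <= l <= hi /\ (Y N v < c -> c < Y N w -> Y N l = c).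
  move=> N; have [[Nv Nw]|bad] := pselect (Y N v < c /\ c < Y N w); last first.
    by exists lo; rewrite lexx; split=> // Nv Nw; case: bad.
  have [cY _] := euler_continuous a_gt0 T_gt0 f_cara m_L1 f_le_m alpha_L1 f_lip (leqnn N.+1).
  have [||l] := @IVT _ (Y N) lo hi c lohi.
  - exact: continuous_subspaceT.
  - rewrite /lo /hi; have [vw|wv] := leP v w.
      by rewrite (min_l (ltW (lt_trans Nv Nw))) (max_r (ltW (lt_trans Nv Nw))) !ltW.
    by rewrite (min_r (ltW (lt_trans Nv Nw))) (max_l (ltW (lt_trans Nv Nw))) !ltW.
  by rewrite in_itv/= => lT Yl; exists l.
have lo_gt : prim m T < lo by rewrite lt_min mv.
have [v0 [y [p [_ cy uy]]]] := euler_limit a_gt0 T_gt0 f_cara m_L1 f_le_m lo_gt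
  (fun N => (lamP N).1) UF Uoo.
have yT : y T = c.
  apply: (cvg_unique (@Rhausdorff R) cy); apply: cvg_near_cst.
  by apply: filterS2 Uv Uw => N Nv Nw; exact: (lamP N).2.
have [[ysol y0 _] _] := fold_unfolded a_gt0 T_gt0 uy.
exists (fold a \o y); split=> //.
by rewrite /= yT (@fold_on _ _ _ k.+1)// ?subrr ?mulr0// /c; apply/andP; split; lra.
Qed.
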